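(* Let $\mathcal{A}': f'=0$ be a nodal arrangement of $d'\geq 2$ lines in $\mathbb{P}^2$ (i.e. all its multiple points are double points), and let $L$ be a line not belonging to $\mathcal{A}'$ such that exactly $s\geq 1$ double points of $\mathcal{A}'$ lie on $L$. Let $\mathcal{A}=\mathcal{A}'\cup L: f=0$ and $d=d'+1=\deg f$. Then: (1) The multiple points of $\mathcal{A}$ are exactly $n_2=\binom{d}{2}-3s$ double points and $n_3=s$ triple points, where $s\leq d'/2$; hence $\tau(\mathcal{A})=\binom{d}{2}+s$. Moreover $\mathrm{mdr}(f)=d-3$. (2) If $d'=2k\geq 4$ is even and $s=k$, then $\mathcal{A}$ is of type $(d,r,m)=(2k+1,2k-2,k)$ (for any $k\geq 2$). Moreover $\Delta m:=(2r-d+3)-m=k-2$, the numerical invariants (degrees) of the minimal graded free resolution of the Milnor algebra $M(f)$ are determined by $k$, and in particular $\epsilon_j=2$ for all $j=1,\ldots,k-2$.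
   Context: Let $S=\mathbb{C}[x,y,z]$. For a reduced homogeneous $f\in S$ of degree $d$ defining a curve (here a line arrangement), let $J_f=(f_x,f_y,f_z)$, $M(f)=S/J_f$, and $D_0(f)=\{(a,b,c)\in S^3: af_x+bf_y+cf_z=0\}$. $\mathrm{mdr}(f)$ denotes the minimal degree of a nonzero homogeneous element of $D_0(f)$. The curve is of type $(d,r,m)$ if $D_0(f)$ is minimally generated by $m$ homogeneous elements all of degree $r$. The total Tjurina number $\tau$ is the degree of $J_f$ (sum of local Tjurina numbers). When $m\geq 3$, the minimal graded free resolution of $M(f)$ has the form $0\to \bigoplus_{i=1}^{m-2}S(-e_i)\to \bigoplus_{j=1}^m S(1-d-d_j)\to S^3(1-d)\to S$, where $d_1\leq\cdots\leq d_m$ are the degrees of minimal generators of $D_0(f)$, $e_1\leq\cdots\leq e_{m-2}$, and one writes $e_j=d+d_{j+2}-1+\epsilon_j$ with integers $\epsilon_j\geq 1$. *)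

(* Defs.v *)
From Stdlib Require Import Reals.
From HB Require Import structures.
From mathcomp Require Import all_boot all_order all_algebra.
From mathcomp Require Import Rstruct complex.
From mathcomp Require Import mpoly.

Set Implicit Arguments.
Unset Strict Implicit.
Unset Printing Implicit Defensive.

Import GRing.Theory Num.Theory.
Local Open Scope ring_scope.

Definition C : closedFieldType := complex R.

Notation S := {mpoly C[3]}.

(** Vectors of C^3: used both for coefficient vectors (a,b,c) of a line
    a x + b y + c z = 0 and for homogeneous coordinates of points of P^2. *)
Notation vec3 := 'rV[C]_3.

Definition linform (l : vec3) : S := \sum_(i < 3) l ord0 i *: 'X_i.

Definition arr_poly (ls : seq vec3) : S := \prod_(l <- ls) linform l.

Definition proportional (u v : vec3) : Prop := exists c : C, c != 0 /\ u = c *: v.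

Definition line_arrangement (ls : seq vec3) : Prop :=
  (forall l, l \in ls -> l != 0) /\
  (forall i j : 'I_(size ls), i != j -> ~ proportional (nth 0 ls i) (nth 0 ls j)).

Definition on_line (l p : vec3) : bool := \sum_(i < 3) l ord0 i * p ord0 i == 0.

Definition pt_mult (ls : seq vec3) (p : vec3) : nat := count (fun l => on_line l p) ls.

Definition nodal (ls : seq vec3) : Prop := forall p : vec3, p != 0 -> (pt_mult ls p <= 2)%N.

(** Normalized representative of a point of P^2: the first nonzero
    coordinate equals 1.  Points of P^2 <-> normalized vectors. *)
Definition normalized (p : vec3) : Prop :=
  exists i : 'I_3, p ord0 i = 1 /\ forall j : 'I_3, (j < i)%N -> p ord0 j = 0.

Definition num_points (P : vec3 -> Prop) (n : nat) : Prop :=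
  exists s : seq vec3, uniq s /\ size s = n /\
    forall p : vec3, p \in s <-> (normalized p /\ P p).

Definition jac (f : S) (i : 'I_3) : S := mderiv i f.

Definition inJ (f : S) (p : S) : Prop :=
  exists a : 'I_3 -> S, p = \sum_(i < 3) a i * jac f i.

Definition dimMk (f : S) (k n : nat) : Prop :=
  exists b : 'I_n -> S,
    (forall i, b i \is k.-homog) /\
    (forall c : 'I_n -> C, inJ f (\sum_i c i *: b i) -> forall i, c i = 0) /\
    (forall p : S, p \is k.-homog -> exists c : 'I_n -> C, inJ f (p - \sum_i c i *: b i)).

(** Total Tjurina number tau(f) = t: the degree of J_f, i.e. the (eventually
    constant) value of the Hilbert function of M(f). *)
Definition tjurina (f : S) (t : nat) : Prop :=
  exists k0 : nat, forall k, (k0 <= k)%N -> dimMk f k t.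

Definition syz (f : S) (v : 'I_3 -> S) : Prop := \sum_(i < 3) v i * jac f i = 0.

Definition homog3 (r : nat) (v : 'I_3 -> S) : Prop := forall i, v i \is r.-homog.

Definition mdr (f : S) (r : nat) : Prop :=
  (exists v, syz f v /\ homog3 r v /\ exists i, v i != 0) /\
  (forall (r' : nat) v, (r' < r)%N -> syz f v -> homog3 r' v -> forall i, v i = 0).

Definition generates (f : S) (m : nat) (g : 'I_m -> 'I_3 -> S) : Prop :=
  forall v, syz f v -> exists h : 'I_m -> S, forall i, v i = \sum_(j < m) h j * g j i.

Definition irredundant (m : nat) (g : 'I_m -> 'I_3 -> S) : Prop :=
  forall j : 'I_m, ~ exists h : 'I_m -> S,
      forall i, g j i = \sum_(l < m | l != j) h l * g l i.

Definition arr_type (f : S) (r m : nat) : Prop :=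
  exists g : 'I_m -> 'I_3 -> S,
    (forall j, syz f (g j)) /\ (forall j, homog3 r (g j)) /\
    generates f g /\ irredundant g.

(** [min_free_res f d m dd ee]: M(f) (f of degree d) has a minimal graded free
    resolution
      0 -> (+)_{i<m-2} S(-ee i) --Rl--> (+)_{j<m} S(1-d-dd j) --g-->
           S^3(1-d) --(f_x,f_y,f_z)--> S -> M(f) -> 0.
    Columns g j are homogeneous syzygies of degree dd j generating D_0(f);
    the entries Rl i j are homogeneous of degree ee i - (d-1+dd j) and
    generate all relations among the g j; Rl is injective; minimality: no
    nonzero entry of degree 0 (nonpositive degree entries vanish). *)
Definition min_free_res (f : S) (d m : nat) (dd : 'I_m -> nat) (ee : 'I_(m - 2) -> nat)
  : Prop :=
  exists (g : 'I_m -> 'I_3 -> S) (Rl : 'I_(m - 2) -> 'I_m -> S),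
    (forall j, syz f (g j)) /\
    (forall j, homog3 (dd j) (g j)) /\
    (forall j i, dd j = 0%N -> g j i = 0) /\
    generates f g /\
    (forall i l, \sum_(j < m) Rl i j * g j l = 0) /\
    (forall i j, Rl i j \is (ee i - (d - 1 + dd j))%N.-homog) /\
    (forall i j, (ee i <= d - 1 + dd j)%N -> Rl i j = 0) /\
    (forall h : 'I_m -> S, (forall l, \sum_(j < m) h j * g j l = 0) ->
       exists c : 'I_(m - 2) -> S, forall j, h j = \sum_(i < m - 2) c i * Rl i j) /\
    (forall c : 'I_(m - 2) -> S, (forall j, \sum_(i < m - 2) c i * Rl i j = 0) ->
       forall i, c i = 0).

(* Main.v *)
(* Work with the derivations [v] of [S] killing the linear form of the added line
   [L], modulo the Euler field these are the syzygies of the gradient of [f].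
   The lines of the nodal arrangement are grouped into pencils through points
   [P_j] of [L], with products [Q_j] of degree at most 2, so that
   [f = L * \prod_j Q_j]. A field killing [L] is a pair of polynomials, and being
   logarithmic means that, for every [j], the linear form cutting out [P_j] on [L]
   takes a value divisible by [Q_j]. Since no three lines of the arrangement are
   concurrent, the [Q_j] are regular modulo each other, pairwise and by triples;
   adding pencils one at a time then shows that these fields are generated by
   [(\prod_(i != j) Q_i) P_j]. The only relations come from the linear
   dependencies [\sum_j c_j P_j = 0] in the plane [L = 0], rescaled into
   [(c_j Q_j)_j]. This yields an exact complex
   [0 -> S^(m-2) -> S^m -> S^3 -> S], whose degrees give the minimal degree of a
   syzygy, the type, the resolution and, by counting dimensions degreewise, the
   Tjurina number. *)

Require Import Defs.
From Stdlib Require Import Reals.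
From HB Require Import structures.
From mathcomp Require Import all_boot all_order all_algebra.
From mathcomp Require Import Rstruct complex.
From mathcomp Require Import mpoly.
From mathcomp Require Import ring zify.
From Stdlib Require Import Classical IndefiniteDescription.
Import GRing.Theory Num.Theory.
Local Open Scope ring_scope.

Set Implicit Arguments.
Unset Strict Implicit.
Unset Printing Implicit Defensive.

(* [Reals] exports a binomial coefficient that is also called [C]. *)
Local Notation K := Defs.C.

(** Syzygies of the gradient and fields killing [linform L] are two normalisations of logarithmic
    fields modulo the Euler field, which multiplies [f] by [d] (invertible in characteristic 0) and
    [linform L] by 1. The second leaves only two coordinates. Triples of pencils are where nodality
    is decisive: when a pencil [c] joins, each earlier coefficient [h i] must be split modulo
    [(Q i, Q c)], so the product of the other earlier [Q j] has to be cancelled modulo that ideal.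
    Three nonconcurrent lines are linear coordinates, which permits it. The numbers come from the
    degrees [q j <= 2] of the [Q j], whose sum is [d - 1]. Generator [j] has degree [d - 1 - q j],
    so one double point on [L] already gives the value [d - 3] of [mdr], and [epsilon = 2] is the
    degree of [Q j] when all pencils are double. In the dimension count, [dim S_(E + q j)] is
    [dim S_E + q j (E + 2)], plus one when [q j = 2]: these units add up to the [s] in the Tjurina
    number. *)

Lemma natr_neq0 n : (n.+1%:R : K) != 0.
Proof. by rewrite /Defs.C pnatr_eq0. Qed.

(* Unfolding the complex numbers makes [ring] and unification diverge. *)
Opaque Defs.C.

(** * Regular elements and planar splines *)

(** [h] is a nonzerodivisor modulo the ideal [(c)], and below modulo [(a, b)]; witnesses take the
    place of quotient rings. *)
Definition regular_mod (R : comNzRingType) (h c : R) : Prop :=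
  forall x u, h * x = c * u -> exists u', x = c * u'.

Definition regular_mod2 (R : comNzRingType) (h a b : R) : Prop :=
  forall x u v, h * x = a * u + b * v -> exists u' v', x = a * u' + b * v'.

Section RegularElements.

Variables (R : idomainType) (T : eqType).
Implicit Types (h a b c : R) (s : seq T) (Q : T -> R).

Lemma regular_mod2C h a b : regular_mod2 h a b -> regular_mod2 h b a.
Proof.
move=> reg x u v e; have [v' [u' ->]] := reg x v u (etrans e (addrC _ _)).
by exists u', v'; rewrite addrC.
Qed.

Lemma regular_mod_prodl s (P : pred T) Q c :
    {in s, forall i, P i -> regular_mod (Q i) c} ->
  regular_mod (\prod_(i <- s | P i) Q i) c.
Proof.
elim: s => [|i s IHs] reg.
  by move=> x u; rewrite big_nil mul1r => ->; exists u.
have regs : regular_mod (\prod_(i <- s | P i) Q i) c.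
  by apply: IHs => j js; apply: reg; rewrite inE js orbT.
rewrite big_cons; case: ifP => Pi // x u; rewrite -mulrA => /reg [|//|y].
  exact: mem_head.
exact: regs.
Qed.

Lemma regular_mod2_prodl s (P : pred T) Q a b :
    {in s, forall i, P i -> regular_mod2 (Q i) a b} ->
  regular_mod2 (\prod_(i <- s | P i) Q i) a b.
Proof.
elim: s => [|i s IHs] reg.
  by move=> x u v; rewrite big_nil mul1r => ->; exists u, v.
have regs : regular_mod2 (\prod_(i <- s | P i) Q i) a b.
  by apply: IHs => j js; apply: reg; rewrite inE js orbT.
rewrite big_cons; case: ifP => Pi // x u v; rewrite -mulrA => /reg [|//|y [w]].
  exact: mem_head.
exact: regs.
Qed.

(** The modulus is peeled factor by factor: [x] is divisible by the first factor, which cancels in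
    the domain and leaves the same problem for the quotient of [x]. *)
Lemma regular_mod_prodr s (P : pred T) h Q :
    {in s, forall i, P i -> Q i != 0 /\ regular_mod h (Q i)} ->
  regular_mod h (\prod_(i <- s | P i) Q i).
Proof.
elim: s => [|i s IHs] reg.
  by move=> x u _; exists x; rewrite big_nil mul1r.
have regs : regular_mod h (\prod_(i <- s | P i) Q i).
  by apply: IHs => j js; apply: reg; rewrite inE js orbT.
rewrite big_cons; case: ifP => Pi // x u e.
have [Qi0 regi] := reg i (mem_head _ _) Pi.
have [x' def_x] : exists x', x = Q i * x' by apply: regi (etrans e (esym (mulrA _ _ _))).
have [|w def_w] := regs x' u; last by exists w; rewrite def_x def_w mulrA.
apply: (mulfI Qi0); transitivity (h * (Q i * x')); first by ring.
by rewrite -def_x e mulrA.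
Qed.

(** With [q] the remaining product, write [x = Q i * x' + c * x'']. Then [Q i * (h * x' - q * u)] is
    a multiple of [c], and cancelling [Q i] modulo [c] puts [h * x'] in [(q, c)]. This is why [Q i]
    must itself be regular modulo [c]. *)
Lemma regular_mod2_prodm s (P : pred T) h Q c :
    {in s, forall i, P i -> regular_mod2 h (Q i) c /\ regular_mod (Q i) c} ->
  regular_mod2 h (\prod_(i <- s | P i) Q i) c.
Proof.
elim: s => [|i s IHs] reg.
  by move=> x u v _; exists x, 0; rewrite big_nil mul1r mulr0 addr0.
have regs : regular_mod2 h (\prod_(i <- s | P i) Q i) c.
  by apply: IHs => j js; apply: reg; rewrite inE js orbT.
rewrite big_cons; case: ifP => Pi //; set q := \prod_(_ <- _ | _) _ in regs *.
move=> x u v e; have [reg2 reg1] := reg i (mem_head _ _) Pi.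
have [|x' [x'' def_x]] := reg2 x (q * u) v; first by rewrite e mulrA.
have [|w def_w] := reg1 (h * x' - q * u) (v - h * x'').
  by transitivity (h * (Q i * x' + c * x'') - Q i * q * u - h * c * x'');
    [ring | rewrite -def_x e; ring].
have [|y [z def_x']] := regs x' u w.
  by rewrite -def_w; ring.
by exists y, (Q i * z + x''); rewrite def_x def_x'; ring.
Qed.

(** Pairwise regularity stands in for coprimality: after dividing by one factor, the quotient is
    still divisible by each of the others. *)
Lemma prod_dvd_regular s (P : pred T) Q x :
    uniq s ->
    {in s &, forall i j, P i -> P j -> i != j -> regular_mod (Q i) (Q j)} ->
    {in s, forall i, P i -> exists u, x = Q i * u} ->
  exists u, x = (\prod_(i <- s | P i) Q i) * u.
Proof.
elim: s x => [|i s IHs] x; first by exists x; rewrite big_nil mul1r.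
move=> /= /andP[is_ us] reg dvd.
have regs : {in s &, forall i j, P i -> P j -> i != j -> regular_mod (Q i) (Q j)}.
  by move=> j k js ks; apply: reg; rewrite inE ?js ?ks orbT.
rewrite big_cons; case: ifP => Pi; last first.
  by apply: IHs => // j js; apply: dvd; rewrite inE js orbT.
have [y def_x] := dvd i (mem_head _ _) Pi.
have [//|//|j js Pj|u def_y] := IHs y.
  have js' : j \in i :: s by rewrite inE js orbT.
  have [v def_x'] := dvd j js' Pj.
  apply: (reg i j _ js' Pi Pj _ y v); rewrite ?mem_head -?def_x //.
  by apply: contraNneq is_ => ->.
by exists u; rewrite def_x def_y mulrA.
Qed.

End RegularElements.

(* Splines on the projective line: pairs [(x, y)] whose pairing with
   [(a i, b i)] is divisible by [Q i] for every [i]. *)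
Section PlanarSplines.

Variables (R : idomainType) (I : eqType) (a b Q : I -> R).

Let cofactor_prod (s : seq I) (i : I) := \prod_(j <- s | j != i) Q j.
Let det i j := a i * b j - a j * b i.

Hypothesis det_unit : forall i j, i != j -> det i j \is a GRing.unit.
Hypothesis reg1 : forall i j, i != j -> regular_mod (Q i) (Q j).
Hypothesis reg2 : forall i j k, i != j -> i != k -> j != k ->
  regular_mod2 (Q i) (Q j) (Q k).

Let cofactor_prodE s i : uniq s -> i \in s ->
  Q i * cofactor_prod s i = \prod_(j <- s) Q j.
Proof. by move=> us si; rewrite (bigD1_seq i). Qed.

Let cofactor_cons c s i : c \notin s -> i \in s ->
  cofactor_prod (c :: s) i = Q c * cofactor_prod s i.
Proof.
move=> cs si; rewrite /cofactor_prod big_cons ifT //.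
by apply: contraNneq cs => ->.
Qed.

Let cofactor_head c s : c \notin s -> cofactor_prod (c :: s) c = \prod_(j <- s) Q j.
Proof.
move=> cs; rewrite /cofactor_prod big_cons eqxx /= [LHS]big_seq_cond [RHS]big_seq.
apply: eq_bigl => j; case: (boolP (j \in s)) => //= js.
by apply: contraNneq cs => <-.
Qed.

Let cofactor_dvd s i j : uniq s -> i \in s -> i != j ->
  exists u, cofactor_prod s j = Q i * u.
Proof.
move=> us si ij; exists (\prod_(k <- filter (predC1 j) s | k != i) Q k).
by rewrite /cofactor_prod -big_filter (bigD1_seq i) ?filter_uniq ?mem_filter /= ?ij.
Qed.

Lemma seq_choice (s : seq I) (P : I -> R -> R -> Prop) :
  {in s, forall i, exists u v, P i u v} ->
  exists u v : I -> R, {in s, forall i, P i (u i) (v i)}.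
Proof.
move=> ex; have tot i : exists uv : R * R, i \in s -> P i uv.1 uv.2.
  case: (boolP (i \in s)) => [/ex [u [v Puv]]|_]; first by exists (u, v).
  by exists (0, 0).
have [uv Puv] := functional_choice _ tot.
by exists (fst \o uv), (snd \o uv) => i /Puv.
Qed.

(** Induction on the number of conditions. The spline is first expanded on the generators for [r];
    the new condition at [c] then constrains the coefficients [h i] enough to rewrite the expansion
    on the generators for [c :: r]. *)
Lemma spline_generators (s : seq I) (x y : R) :
    uniq s -> (2 <= size s)%N ->
    {in s, forall i, exists t, a i * y - b i * x = Q i * t} ->
  exists h : I -> R,
    x = \sum_(i <- s) h i * cofactor_prod s i * a i /\
    y = \sum_(i <- s) h i * cofactor_prod s i * b i.
Proof.
elim: s x y => [|c [|z [|z' s]] IHs] //= x y.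
  rewrite inE andbT => cz _ spl.
  have [t0 e0] := spl c (mem_head _ _).
  have [|t1 e1] := spl z; first by rewrite !inE eqxx orbT.
  (* Two conditions: Cramer's rule recovers [x] and [y] from the two pairings. *)
  have D1 := mulVr (det_unit cz); rewrite /det in D1; set D' := _^-1 in D1.
  have cofc : cofactor_prod [:: c; z] c = Q z.
    by rewrite cofactor_head ?inE // big_seq1.
  have cofz : cofactor_prod [:: c; z] z = Q c.
    by rewrite cofactor_cons ?inE ?eqxx // /cofactor_prod big_cons eqxx /= big_nil mulr1.
  exists (fun i => if i == c then - D' * t1 else D' * t0).
  rewrite !big_cons !big_nil !addr0 eqxx eq_sym (negPf cz) cofc cofz.
  split.
    transitivity (D' * (a z * (Q c * t0) - a c * (Q z * t1))); last by ring.
    by rewrite -e0 -e1 -[LHS]mul1r -D1; ring.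
  transitivity (D' * (b z * (Q c * t0) - b c * (Q z * t1))); last by ring.
  by rewrite -e0 -e1 -[LHS]mul1r -D1; ring.
set r := [:: z, z' & s] in IHs *.
rewrite -/r => /andP[cr ur0] _ spl; have {ur0} ur : uniq r := ur0.
have [||h [def_x def_y]] := IHs x y ur; first by [].
  by move=> i ir; apply: spl; rewrite inE ir orbT.
have [t e] := spl c (mem_head _ _).
have neq_c i : i \in r -> c != i by move=> ir; apply: contraNneq cr => ->.
have sum_e : \sum_(i <- r) h i * cofactor_prod r i * det c i = Q c * t.
  rewrite -e def_x def_y !mulr_sumr -sumrB; apply: eq_bigr => i _.
  by rewrite /det; ring.
set F := \prod_(j <- r) Q j.
(* In [sum_e] every term other than the [i]-th is a multiple of [Q i], so [h i] times its cofactor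
   lies in [(Q i, Q c)] up to a unit. The cofactor, a product of other [Q j], cancels modulo that
   ideal. *)
have [|g [u hE]] := @seq_choice r (fun i g u => h i = Q i * g + Q c * u).
  move=> i ir.
  have Uci := det_unit (neq_c i ir).
  have [w def_w] : exists w, \sum_(j <- r | j != i) h j * cofactor_prod r j * det c j
                        = Q i * w.
    apply: (big_ind (fun p => exists w, p = Q i * w)).
    - by exists 0; rewrite mulr0.
    - by move=> _ _ [p ->] [q ->]; exists (p + q); rewrite mulrDr.
    move=> j; rewrite eq_sym => ij; have [v ->] := cofactor_dvd ur ir ij.
    by exists (h j * v * det c j); ring.
  have reg_cof : regular_mod2 (cofactor_prod r i) (Q i) (Q c).
    apply: regular_mod2_prodl => j jr ji; apply: reg2 => //.
      by rewrite eq_sym neq_c.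
    by rewrite eq_sym neq_c.
  have [|g [v def_g]] := reg_cof (h i * det c i) (- w) t.
    by rewrite mulrN -def_w -sum_e (bigD1_seq i) //=; ring.
  exists (g / det c i), (v / det c i).
  by rewrite -[LHS](mulrK Uci) def_g; ring.
have sumF (k : I -> R) : \sum_(i <- r) h i * cofactor_prod r i * k i =
    F * (\sum_(i <- r) g i * k i) + \sum_(i <- r) u i * (Q c * cofactor_prod r i) * k i.
  rewrite mulr_sumr -big_split; apply: eq_big_seq => i ir.
  by rewrite (hE i ir) /F -(cofactor_prodE ur ir) /=; ring.
(* The [u] part of [h] already yields generators for [c :: r]. What remains is [F] times the vector
   [(A, B)] formed with the [g i], and cancelling [F] modulo [Q c] shows that this vector satisfies
   the condition at [c]. *)
have [t' def_t'] : exists t', \sum_(i <- r) g i * det c i = Q c * t'.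
  have regF : regular_mod F (Q c).
    by apply: regular_mod_prodl => j jr _; apply: reg1; rewrite eq_sym neq_c.
  apply: (regF _ (t - \sum_(i <- r) u i * cofactor_prod r i * det c i)).
  rewrite mulrBr -sum_e sumF [Q c * _]mulr_sumr -addrA -sumrB [X in _ + X]big1 ?addr0 // => i _.
  by ring.
set A := \sum_(i <- r) g i * a i; set B := \sum_(i <- r) g i * b i.
have zr : z \in r by rewrite mem_head.
have Ucz := det_unit (neq_c z zr).
have detAB : a c * B - b c * A = Q c * t'.
  rewrite -def_t' !mulr_sumr -sumrB; apply: eq_bigr => i _; rewrite /det; ring.
(* Coordinates of [(A, B)] in the basis given by [c] and [z]; the [z] coordinate is [n * Q c]. *)
set m := (A * b z - a z * B) / det c z; set n := t' / det c z.
have defA : A = m * a c + n * Q c * a z.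
  apply: (mulIr Ucz).
  transitivity ((A * b z - a z * B) * a c + (Q c * t') * a z).
    by rewrite -detAB /det; ring.
  by rewrite mulrDl /m /n -[LHS]mulr1 -{1}(mulVr Ucz); ring.
have defB : B = m * b c + n * Q c * b z.
  apply: (mulIr Ucz).
  transitivity ((A * b z - a z * B) * b c + (Q c * t') * b z).
    by rewrite -detAB /det; ring.
  by rewrite mulrDl /m /n -[LHS]mulr1 -{1}(mulVr Ucz); ring.
(* [F] is the cofactor of [c], hence the coefficient [m]; and [F * Q c] is [Q z] times the new
   cofactor of [z], hence the correction [n * Q z]. *)
exists (fun i => if i == c then m else u i + (i == z)%:R * (n * Q z)).
have final (k : I -> R) K : \sum_(i <- r) g i * k i = K ->
    K = m * k c + n * Q c * k z ->
    \sum_(i <- r) h i * cofactor_prod r i * k i =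
    \sum_(i <- c :: r) (if i == c then m else u i + (i == z)%:R * (n * Q z)) *
       cofactor_prod (c :: r) i * k i.
  move=> sumk defK; rewrite sumF sumk defK [in RHS]big_cons eqxx cofactor_head // -/F.
  rewrite [in RHS](eq_big_seq (fun i => u i * (Q c * cofactor_prod r i) * k i
       + (i == z)%:R * (n * Q z * (Q c * cofactor_prod r i) * k i))); last first.
    move=> i ir; rewrite [i == c]eq_sym (negPf (neq_c i ir)) cofactor_cons //.
    by ring.
  rewrite big_split /= [X in _ + (_ + X)](bigD1_seq z) //= eqxx mul1r.
  rewrite [X in _ + (_ + (_ + X))]big1 ?addr0; last first.
    by move=> i /negPf ->; rewrite mul0r.
  by rewrite /F -(cofactor_prodE ur zr); ring.
by split; [rewrite {1}def_x | rewrite {1}def_y]; apply: final; [| exact: defA | | exact: defB].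
Qed.

(** Pair the relation with some [k != i], which exists because there are two indices. Modulo [Q i]
    only the [i]-th term survives, its determinant is a unit and its cofactor is regular, so [Q i]
    divides [h i]. The common factor, the product of all [Q j], then cancels. *)
Lemma spline_relations (s : seq I) (h : I -> R) :
    uniq s -> (2 <= size s)%N -> {in s, forall i, Q i != 0} ->
    \sum_(i <- s) h i * cofactor_prod s i * a i = 0 ->
    \sum_(i <- s) h i * cofactor_prod s i * b i = 0 ->
  exists g : I -> R, [/\ {in s, forall i, h i = Q i * g i},
    \sum_(i <- s) g i * a i = 0 & \sum_(i <- s) g i * b i = 0].
Proof.
move=> us s2 Q0 suma sumb.
have sum0 i : \sum_(j <- s) h j * cofactor_prod s j * det i j = 0.
  transitivity (a i * (\sum_(j <- s) h j * cofactor_prod s j * b j) -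
                b i * (\sum_(j <- s) h j * cofactor_prod s j * a j)).
    by rewrite !mulr_sumr -sumrB; apply: eq_bigr => j _; rewrite /det; ring.
  by rewrite suma sumb !mulr0 subrr.
have [|g [_ hE]] := @seq_choice s (fun i g _ => h i = Q i * g).
  move=> i is_; suff [g ->] : exists g, h i = Q i * g by exists g, 0.
  have [k ks ki] : exists2 k, k \in s & k != i.
    case: s us s2 is_ {Q0 suma sumb sum0} => [|k [|k' s]] //= /andP[+ _] _ _.
    rewrite inE negb_or => /andP[kk' _].
    have [ki|] := eqVneq k i; last by exists k; rewrite ?mem_head.
    by exists k'; rewrite ?inE ?eqxx ?orbT // -ki eq_sym.
  have reg_cof : regular_mod (cofactor_prod s i) (Q i).
    by apply: regular_mod_prodl => j js ji; apply: reg1.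
  have [w def_w] : exists w, \sum_(j <- s | j != i) h j * cofactor_prod s j * det k j
                        = Q i * w.
    apply: (big_ind (fun p => exists w, p = Q i * w)).
    - by exists 0; rewrite mulr0.
    - by move=> _ _ [p ->] [q ->]; exists (p + q); rewrite mulrDr.
    move=> j; rewrite eq_sym => ij; have [v ->] := cofactor_dvd us is_ ij.
    by exists (h j * v * det k j); ring.
  have [|v def_v] := reg_cof (h i * det k i) (- w).
    apply: (addIr (Q i * w)); rewrite mulrN addNr -[RHS](sum0 k) -def_w.
    by rewrite [RHS](bigD1_seq i) //=; ring.
  exists (v / det k i).
  by rewrite -[LHS](mulrK (det_unit ki)) def_v; ring.
exists g.
have F0 : \prod_(j <- s) Q j != 0.
  by rewrite prodf_seq_neq0; apply/allP => j /Q0.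
have sumF (k : I -> R) : \sum_(i <- s) h i * cofactor_prod s i * k i =
    (\prod_(j <- s) Q j) * \sum_(i <- s) g i * k i.
  rewrite mulr_sumr; apply: eq_big_seq => i si.
  by rewrite (hE i si) -(cofactor_prodE us si); ring.
split=> //; apply: (mulfI F0); rewrite mulr0 -sumF //.
Qed.

End PlanarSplines.

(** * Linear forms *)

Definition dot (l p : vec3) : K := \sum_(i < 3) l ord0 i * p ord0 i.
Definition dotS (l : vec3) (v : 'I_3 -> S) : S := \sum_(i < 3) l ord0 i *: v i.

Lemma on_lineE l p : on_line l p = (dot l p == 0). Proof. by []. Qed.

Lemma linformE l : linform l = dotS l (fun i => 'X_i). Proof. by []. Qed.

Lemma dotZr l c p : dot l (c *: p) = c * dot l p.
Proof.
by rewrite /dot mulr_sumr; apply: eq_bigr => j _; rewrite mxE mulrCA.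
Qed.

Lemma dotDr l p q : dot l (p + q) = dot l p + dot l q.
Proof.
by rewrite /dot -big_split; apply: eq_bigr => j _; rewrite mxE mulrDr.
Qed.

Lemma dot0r l : dot l 0 = 0.
Proof. by rewrite /dot big1 // => i _; rewrite mxE mulr0. Qed.

Lemma dotSM l (h : S) v : dotS l (fun i => h * v i) = h * dotS l v.
Proof. by rewrite /dotS mulr_sumr; apply: eq_bigr => j _; rewrite scalerAr. Qed.

Lemma dotSD l v w : dotS l (fun i => v i + w i) = dotS l v + dotS l w.
Proof. by rewrite /dotS -big_split; apply: eq_bigr => j _; rewrite scalerDr. Qed.

Lemma dotSC l (p : vec3) : dotS l (fun i => (p ord0 i)%:MP) = (dot l p)%:MP.
Proof.
by rewrite /dotS /dot rmorph_sum; apply: eq_bigr => j _; rewrite -mul_mpolyC -mpolyCM.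
Qed.

Lemma eq_dotS l v w : v =1 w -> dotS l v = dotS l w.
Proof. by move=> e; apply: eq_bigr => i _; rewrite e. Qed.

Lemma linform_mcoeff l j : (linform l)@_(U_(j)) = l ord0 j.
Proof.
rewrite raddf_sum /= (bigD1 j) //= mcoeffZ mcoeffX eqxx mulr1 big1 ?addr0 //.
by move=> i ij; rewrite mcoeffZ mcoeffX eq_mnm1 (negPf ij) mulr0.
Qed.

Lemma linformB l l' : linform (l - l') = linform l - linform l'.
Proof.
by rewrite /linform -sumrB; apply: eq_bigr => i _; rewrite !mxE scalerBl.
Qed.

Lemma linformZ c l : linform (c *: l) = c *: linform l.
Proof.
by rewrite /linform scaler_sumr; apply: eq_bigr => i _; rewrite !mxE scalerA.
Qed.

Lemma linform_eq0 l : (linform l == 0) = (l == 0).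
Proof.
apply/eqP/eqP => [l0|->]; last first.
  by rewrite /linform big1 // => i _; rewrite mxE scale0r.
by apply/rowP => i; rewrite -linform_mcoeff l0 mcoeff0 mxE.
Qed.

Lemma linform_homog l : linform l \is 1.-homog.
Proof. by apply: rpred_sum => i _; apply: rpredZ; rewrite dhomogX /= mdeg1. Qed.

Lemma mderiv_linform l i : mderiv i (linform l) = (l ord0 i)%:MP.
Proof.
rewrite raddf_sum /= (bigD1 i) //= big1 ?addr0 => [|j ji].
  rewrite mderivZ mderivX mnm1E eqxx scale1r -mul_mpolyC.
  have -> : (U_(i) - U_(i) = 0 :> 'X_{1..3})%MM by apply/mnmP => k; rewrite mnmBE subnn mnm0E.
  by rewrite mpolyX0 mulr1.
by rewrite mderivZ mderivX mnm1E (negPf ji) scale0r scaler0.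
Qed.

Lemma linform_meval l (p : vec3) : (linform l).@[fun i => p ord0 i] = dot l p.
Proof.
by rewrite raddf_sum; apply: eq_bigr => i _; rewrite /= mevalZ mevalXU.
Qed.

Lemma linform_subst l (t : 'I_3 -> S) :
  linform l \mPo [tuple t i | i < 3] = dotS l t.
Proof.
rewrite raddf_sum; apply: eq_bigr => i _.
by rewrite /= comp_mpolyZ comp_mpolyXU -tnth_nth tnth_mktuple.
Qed.

Lemma substM (t : 3.-tuple S) (p q : S) : (p * q) \mPo t = (p \mPo t) * (q \mPo t).
Proof. exact: (rmorphM (comp_mpoly t)). Qed.

Lemma substD (t : 3.-tuple S) (p q : S) : (p + q) \mPo t = (p \mPo t) + (q \mPo t).
Proof. exact: (rmorphD (comp_mpoly t)). Qed.

(** [P] is membership in an ideal containing every ['X_i - t i], so the substitution is the identity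
    modulo it. Applied to the ideals of one and of two linear forms, this bounds the kernel of a
    projection. *)
Lemma subst_congruence (P : S -> Prop) (t : 'I_3 -> S) :
    P 0 -> (forall p q, P p -> P q -> P (p + q)) -> (forall p q, P p -> P (q * p)) ->
    (forall i, P ('X_i - t i)) ->
  forall p, P (p - (p \mPo [tuple t i | i < 3])).
Proof.
move=> P0 PD PM Pt; pose good p := P (p - (p \mPo [tuple t i | i < 3])).
suff : forall p, good p by [].
have goodM p q : good p -> good q -> good (p * q).
  rewrite /good substM => gp gq.
  move: (p \mPo _) (q \mPo _) gp gq => p' q' gp gq.
  have -> : p * q - p' * q' = q * (p - p') + p' * (q - q') by ring.
  by apply: PD; apply: PM.
have goodC c : good c%:MP by rewrite /good comp_mpolyC subrr.
have goodD p q : good p -> good q -> good (p + q).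
  rewrite /good substD => gp gq.
  move: (p \mPo _) (q \mPo _) gp gq => p' q' gp gq.
  have -> : p + q - (p' + q') = (p - p') + (q - q') by ring.
  exact: PD.
have good0 : good 0 by rewrite -mpolyC0; exact: goodC.
have good1 : good 1 by rewrite -mpolyC1; exact: goodC.
have goodX i : good 'X_i by rewrite /good comp_mpolyXU -tnth_nth tnth_mktuple; exact: Pt.
clearbody good => p; rewrite [p]mpolyE; apply: (big_ind good); [exact: good0 | exact: goodD |].
move=> m _; rewrite -mul_mpolyC; apply: (goodM); first exact: goodC.
rewrite mpolyXE_id; apply: (big_ind good); [exact: good1 | exact: goodM |].
move=> i _; elim: (m i) => [|k IHk]; first by rewrite expr0.
by rewrite exprS; apply: (goodM); [exact: goodX |].
Qed.

(** Eliminating one variable by [l' = 0] kills [linform l'] but not [linform l]. As [S] is a domain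
    the image of [x] vanishes, and [x] is congruent to its image modulo [linform l']. *)
Lemma regular_linform l l' :
  l' != 0 -> (forall c, l <> c *: l') -> regular_mod (linform l) (linform l').
Proof.
move=> l'0 nprop x u e.
have [i l'i] : exists i, l' ord0 i != 0 by apply/rV0Pn.
pose t j : S := 'X_j - ((j == i)%:R / l' ord0 i) *: linform l'.
pose psi := comp_mpoly [tuple t i | i < 3].
have psiE k : psi (linform k) = linform (k - (k ord0 i / l' ord0 i) *: l').
  rewrite /psi linform_subst linformB linformZ /dotS /t.
  under eq_bigr do rewrite scalerBr scalerA.
  rewrite sumrB -scaler_suml; congr (_ - _ *: _).
  rewrite (bigD1 i) //= eqxx big1 ?addr0 ?mul1r // => j /negPf ->.
  by rewrite mul0r mulr0.
have cong p : exists u', p - psi p = linform l' * u'.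
  apply: (@subst_congruence (fun p => exists u', p = linform l' * u')).
  - by exists 0; rewrite mulr0.
  - by move=> _ _ [p1 ->] [q ->]; exists (p1 + q); rewrite mulrDr.
  - by move=> _ q [p1 ->]; exists (q * p1); rewrite mulrCA.
  move=> j; exists (((j == i)%:R / l' ord0 i)%:MP); rewrite /t [linform l' * _]mulrC mul_mpolyC.
  by rewrite opprB addrC subrK.
have : psi (linform l) * psi x = 0.
  rewrite -substM e substM -/psi psiE divff // scale1r subrr.
  by rewrite (eqP (_ : linform 0 == 0)) ?mul0r // linform_eq0.
move/eqP; rewrite mulf_eq0 psiE linform_eq0 subr_eq0 => /orP[/eqP /nprop //|/eqP psix].
by have [u'] := cong x; rewrite psix subr0 => ->; exists u'.
Qed.

Definition rows3 (u v w : vec3) : 'M[K]_3 := \matrix_(i < 3) nth 0 [:: u; v; w] i.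

Lemma sum3 (V : nmodType) (F : 'I_3 -> V) :
  \sum_(i < 3) F i = F ord0 + F (lift ord0 ord0) + F (lift ord0 (lift ord0 ord0)).
Proof. by rewrite !big_ord_recl big_ord0 addr0 addrA. Qed.

Lemma rows3_unit (u v w : vec3) :
  (forall x y z, x *: u + y *: v + z *: w = 0 -> [/\ x = 0, y = 0 & z = 0]) ->
  rows3 u v w \in unitmx.
Proof.
move=> indep; rewrite unitmxE unitfE; apply/det0P => -[k k0 kM].
case/negP: k0; apply/eqP/rowP.
have [|x0 y0 z0] := indep (k ord0 ord0) (k ord0 (lift ord0 ord0))
  (k ord0 (lift ord0 (lift ord0 ord0))).
  rewrite -[RHS]kM; apply/rowP => j; rewrite !mxE sum3 /rows3 !mxE /=.
  by [].
by move=> i; rewrite mxE; case: (unliftP ord0 i) => [i'|] -> //;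
  case: (unliftP ord0 i') => [i''|] -> //; rewrite (ord1 i'').
Qed.

(* Any covector annihilating two independent vectors [U], [V] completes the
   dual basis: this resolves the identity along [U], [V] and a third direction. *)
Lemma plane_frame (L U V : vec3) :
    L != 0 -> dot L U = 0 -> dot L V = 0 ->
    (forall x y, x *: U + y *: V = 0 -> x = 0 /\ y = 0) ->
  exists a b w : vec3, forall i j,
    (i == j)%:R = U ord0 i * a ord0 j + V ord0 i * b ord0 j + w ord0 i * L ord0 j.
Proof.
move=> L0 LU LV indep.
have [k Lk] : exists i, L ord0 i != 0 by apply/rV0Pn.
pose w : vec3 := (L ord0 k)^-1 *: delta_mx ord0 k.
have Lw : dot L w = 1.
  rewrite dotZr /dot (bigD1 k) //= big1 => [|j /negPf jk].
    by rewrite mxE !eqxx addr0 mulr1 mulVf.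
  by rewrite mxE jk andbF mulr0.
clearbody w.
have uM : rows3 U V w \in unitmx.
  apply: rows3_unit => x y z e.
  have z0 : z = 0.
    have : dot L (x *: U + y *: V + z *: w) = 0 by rewrite e dot0r.
    by rewrite !dotDr !dotZr LU LV Lw !mulr0 !add0r mulr1.
  by move: e; rewrite z0 scale0r addr0 => /indep [].
set M := rows3 U V w in uM; pose N := invmx M.
have NM : N *m M = 1%:M by rewrite mulVmx.
have ML : M *m L^T = delta_mx ord_max 0.
  apply/colP => i; rewrite !mxE.
  transitivity (dot L (nth 0 [:: U; V; w] i)).
    by apply: eq_bigr => j _; rewrite !mxE mulrC.
  case: (unliftP ord0 i) => [i'|] -> //=; rewrite ?LU //.
  by case: (unliftP ord0 i') => [i''|] -> //=; rewrite ?LV ?(ord1 i'') ?Lw.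
have NL i : N i ord_max = L ord0 i.
  have : L^T = N *m delta_mx ord_max 0 by rewrite -ML mulmxA NM mul1mx.
  by move/colP/(_ i); rewrite mxE => ->; rewrite -colE mxE.
have Nw : M *m N = 1%:M by rewrite mulmxV.
exists (row ord0 N^T), (row (lift ord0 ord0) N^T), w; move=> i j.
have : (N *m M) j i = (j == i)%:R by rewrite NM mxE.
rewrite eq_sym => <-; rewrite !mxE sum3 !mxE /= -NL.
rewrite [ord_max](_ : _ = lift ord0 (lift ord0 ord0)); last exact: val_inj.
by rewrite ![_ * N _ _]mulrC.
Qed.

Lemma common_point (l l' : vec3) : exists2 p : vec3, p != 0 & on_line l p && on_line l' p.
Proof.
pose A : 'M[K]_(3, 2) := \matrix_(i < 3, j < 2) nth 0 [:: l; l'] j ord0 i.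
have : kermx A != 0.
  by rewrite -mxrank_eq0 mxrank_ker subn_eq0 -ltnNge ltnS rank_leq_col.
case/rowV0Pn => p /sub_kermxP pA p0; exists p => //.
have dotp (j : 'I_2) : dot (nth 0 [:: l; l'] j) p = 0.
  move/rowP/(_ j): pA; rewrite !mxE => <-.
  by apply: eq_bigr => i _; rewrite !mxE mulrC.
by rewrite !on_lineE (dotp ord0) (dotp ord_max) eqxx.
Qed.

(** Without a common zero, [a], [b], [l] are linear coordinates. The substitution [psi] sets the
    first two to 0 and fixes the third, so [psi x = 0], while [x] is congruent to [psi x] modulo the
    two forms. *)
Lemma regular2_linform l a b :
    (forall p : vec3, p != 0 -> ~~ [&& on_line l p, on_line a p & on_line b p]) ->
  regular_mod2 (linform l) (linform a) (linform b).
Proof.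
move=> indep x u v e.
have uM : rows3 a b l \in unitmx.
  rewrite unitmxE unitfE -det_tr; apply/det0P => -[k k0 kM].
  have kill i : dot (nth 0 [:: a; b; l] i) k = 0 \/ (3 <= i)%N.
    case: (ltnP i 3) => [i3|]; [left|by right].
    move/rowP/(_ (Ordinal i3)): kM; rewrite !mxE => <-.
    by apply: eq_bigr => j _; rewrite !mxE mulrC.
  case/negP: (indep k k0); rewrite !on_lineE.
  by have [] := kill 0%N => // ->; have [] := kill 1%N => // ->;
     have [] := kill 2%N => // ->; rewrite eqxx.
set M := rows3 a b l in uM; pose N := invmx M.
have NM : N *m M = 1%:M by rewrite mulVmx.
have MN : M *m N = 1%:M by rewrite mulmxV.
pose t j : S := N j ord_max *: linform l.
pose psi := comp_mpoly [tuple t i | i < 3].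
have psiE (k : 'I_3) : psi (linform (nth 0 [:: a; b; l] k)) = (k == ord_max)%:R *: linform l.
  rewrite /psi linform_subst /dotS /t.
  have <- : (M *m N) k ord_max = (k == ord_max)%:R by rewrite MN mxE.
  rewrite mxE scaler_suml; apply: eq_bigr => j _.
  by rewrite scalerA !mxE.
have cong p : exists u' v', p - psi p = linform a * u' + linform b * v'.
  apply: (@subst_congruence (fun p => exists u' v', p = linform a * u' + linform b * v')).
  - by exists 0, 0; rewrite !mulr0 addr0.
  - move=> _ _ [p1 [p2 ->]] [q1 [q2 ->]]; exists (p1 + q1), (p2 + q2); ring.
  - by move=> _ q [p1 [p2 ->]]; exists (q * p1), (q * p2); ring.
  move=> j; exists (N j ord0)%:MP, (N j (lift ord0 ord0))%:MP.
  have -> : 'X_j = \sum_(k < 3) N j k *: linform (nth 0 [:: a; b; l] k).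
    transitivity (\sum_(i < 3) (N *m M) j i *: ('X_i : S)).
      rewrite NM (bigD1 j) //= mxE eqxx scale1r big1 ?addr0 // => i.
      by rewrite mxE eq_sym => /negPf ->; rewrite scale0r.
    under eq_bigr do rewrite mxE scaler_suml.
    rewrite exchange_big /=; apply: eq_bigr => k _; rewrite scaler_sumr.
    by apply: eq_bigr => i _; rewrite scalerA !mxE.
  rewrite sum3 /t /= [ord_max](_ : _ = lift ord0 (lift ord0 ord0)); last exact: val_inj.
  by rewrite addrK -!mul_mpolyC ![_%:MP * _]mulrC.
have psia : psi (linform a) = 0 by rewrite (psiE ord0) scale0r.
have psib : psi (linform b) = 0 by rewrite (psiE (lift ord0 ord0)) scale0r.
have psil : psi (linform l) = linform l by rewrite (psiE ord_max) scale1r.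
have l0 : linform l != 0.
  rewrite linform_eq0; apply/eqP => l0; have [p p0 /andP[ap bp]] := common_point a b.
  case/negP: (indep p p0); rewrite ap bp l0 !andbT on_lineE /dot big1 // => k _.
  by rewrite mxE mul0r.
have psiM p q : psi (p * q) = psi p * psi q by exact: substM.
have psiD p q : psi (p + q) = psi p + psi q by exact: substD.
clearbody psi.
have : psi (linform l * x) = 0.
  by rewrite e psiD !psiM psia psib !mul0r addr0.
rewrite psiM psil => /eqP; rewrite mulf_eq0 (negPf l0) => /eqP psix.
by have [u' [v']] := cong x; rewrite psix subr0 => ->; exists u', v'.
Qed.

(** * Points, lines and incidences *)

Lemma normalized_neq0 p : normalized p -> p != 0.
Proof.
case=> i [pi _]; apply: contra_eq_neq pi => ->.
by rewrite mxE eq_sym oner_eq0.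
Qed.

Lemma on_lineZ l c p : c != 0 -> on_line l (c *: p) = on_line l p.
Proof. by move=> c0; rewrite !on_lineE dotZr mulf_eq0 (negPf c0). Qed.

Lemma normalize (p : vec3) : p != 0 -> exists2 c : K, c != 0 & normalized (c *: p).
Proof.
move/rV0Pn => -[i pi].
have [k pk mink] := @arg_minnP _ i (fun i => p ord0 i != 0) (@nat_of_ord 3) pi.
exists (p ord0 k)^-1; first by rewrite invr_eq0.
exists k; split=> [|j jk]; first by rewrite mxE mulVf.
rewrite mxE; case: (eqVneq (p ord0 j) 0) => [->|/mink]; first by rewrite mulr0.
by rewrite leqNgt jk.
Qed.

Lemma normalized_scale p c : normalized p -> normalized (c *: p) -> c *: p = p.
Proof.
move=> [i [pi p_lt]] [k [pk ck_lt]].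
have c0 : c != 0.
  by apply: contra_eq_neq pk => ->; rewrite scale0r mxE eq_sym oner_eq0.
have ik : i = k.
  case: (ltngtP i k) => [lt|lt|]; last exact: val_inj.
    by move/eqP: (ck_lt i lt); rewrite mxE pi mulr1 (negPf c0).
  by move/eqP: pk; rewrite mxE p_lt // mulr0 eq_sym oner_eq0.
by move: pk; rewrite -ik mxE pi mulr1 => ->; rewrite scale1r.
Qed.

Lemma normalized_indep (U V : vec3) : normalized U -> normalized V -> U != V ->
  forall x y : K, x *: U + y *: V = 0 -> x = 0 /\ y = 0.
Proof.
move=> nU nV UV x y e.
have [x0|x0] := eqVneq x 0.
  split=> //; move: e; rewrite x0 scale0r add0r => /eqP.
  by rewrite scaler_eq0 (negPf (normalized_neq0 nV)) orbF => /eqP.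
case/eqP: UV; have eU : U = (- (x^-1 * y)) *: V.
  rewrite -[LHS]scale1r -(mulVf x0) -scalerA (eqP (_ : x *: U == - (y *: V))).
    by rewrite scalerN scalerA scaleNr.
  by rewrite -addr_eq0 e.
by rewrite eU; apply: normalized_scale => //; rewrite -eU.
Qed.

(** In the dual frame of [plane_frame] the components of [l] are its values at [U], [V] and [w];
    only the last one, along [L], is left. *)
Lemma line_through (l L U V : vec3) : normalized U -> normalized V -> U != V ->
    L != 0 -> on_line L U -> on_line L V -> on_line l U -> on_line l V ->
  exists c, l = c *: L.
Proof.
rewrite !on_lineE => nU nV UV L0 /eqP LU /eqP LV /eqP lU /eqP lV.
have [a [b [w frame]]] := plane_frame L0 LU LV (normalized_indep nU nV UV).
exists (dot l w); apply/rowP => j; rewrite mxE.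
transitivity (\sum_i l ord0 i * (i == j)%:R).
  by rewrite (bigD1 j) //= eqxx mulr1 big1 ?addr0 // => i /negPf ->; rewrite mulr0.
transitivity (dot l U * a ord0 j + dot l V * b ord0 j + dot l w * L ord0 j).
  rewrite /dot !mulr_suml -!big_split; apply: eq_bigr => i _.
  by rewrite frame /=; ring.
by rewrite lU lV !mul0r !add0r.
Qed.

Definition meets (l l' p : vec3) := [/\ normalized p, on_line l p & on_line l' p].

Lemma meets_exists l l' : exists p, meets l l' p.
Proof.
have [p p0 /andP[lp l'p]] := common_point l l'.
have [c c0 np] := normalize p0.
by exists (c *: p); split; rewrite ?on_lineZ.
Qed.

(** [line_arrangement] restated by membership instead of positions, with the form of
    non-proportionality that [regular_linform] expects; the scalar may be 0 since lines are
    nonzero. *)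
Definition distinct_lines (A : seq vec3) : Prop :=
  [/\ uniq A, {in A, forall l, l != 0} &
      {in A &, forall l l', l != l' -> forall c, l <> c *: l'}].

Lemma distinct_linesP A : line_arrangement A -> distinct_lines A.
Proof.
case=> nz np.
have neq l l' c : l \in A -> l = c *: l' -> proportional l l'.
  move=> lA e; exists c; split=> //; apply: contraTneq (nz l lA) => c0.
  by rewrite e c0 scale0r eqxx.
split=> [|l /nz //|l l' lA l'A ll' c e].
  apply/(uniqP 0) => i j iA jA eij; apply/eqP/negPn/negP => ij.
  apply: (np (Ordinal iA) (Ordinal jA)) => //=.
  by rewrite eij; exists 1; rewrite oner_eq0 scale1r.
have iA := lA; have jA := l'A; rewrite -index_mem in iA; rewrite -index_mem in jA.
apply: (np (Ordinal iA) (Ordinal jA)); rewrite /= ?nth_index //; last exact: neq e.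
by apply: contra ll' => /eqP [/(congr1 (nth 0 A))]; rewrite !nth_index // => ->.
Qed.

Lemma distinct_lines_rcons A L : distinct_lines A -> L != 0 ->
  (forall l, l \in A -> ~ proportional L l) -> distinct_lines (rcons A L).
Proof.
move=> [uA nz np] L0 npL; split.
- rewrite rcons_uniq uA andbT; apply/negP => /npL; apply.
  by exists 1; rewrite oner_eq0 scale1r.
- by move=> l; rewrite mem_rcons inE => /orP[/eqP -> //|/nz].
move=> l l'; rewrite !mem_rcons !inE => /orP[/eqP->|lA] /orP[/eqP->|l'A].
- by rewrite eqxx.
- move=> _ c e; apply: (npL l' l'A); exists c; split=> //.
  by apply: contraNneq L0 => c0; rewrite e c0 scale0r.
- move=> _ c e; apply: (npL l lA).
  have c0 : c != 0 by apply: contraNneq (nz l lA) => c0; rewrite e c0 scale0r.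
  by exists c^-1; split; rewrite ?invr_eq0 // e scalerA mulVf // scale1r.
exact: np.
Qed.

Lemma distinct_lines_meet A l l' p q : distinct_lines A -> l \in A -> l' \in A ->
  l != l' -> meets l l' p -> meets l l' q -> p = q.
Proof.
move=> [_ nz np] lA l'A ll' [np_ lp l'p] [nq lq l'q].
apply/eqP/negPn/negP => pq.
have [c] := line_through np_ nq pq (nz l' l'A) l'p l'q lp lq.
exact: np.
Qed.

Lemma sum_count (T U : Type) (r : seq T) (A : seq U) (P : U -> T -> bool) :
  (\sum_(p <- r) count (P^~ p) A = \sum_(l <- A) count (P l) r)%N.
Proof.
under eq_bigr do rewrite -sum1_count big_mkcond.
rewrite exchange_big; apply: eq_bigr => l _.
by rewrite -sum1_count [in RHS]big_mkcond.
Qed.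

Lemma count_pairs (T : eqType) (A : seq T) (P : pred T) : uniq A ->
  (count P A * (count P A).-1 =
     \sum_(l <- A) \sum_(l' <- A | l' != l) (P l && P l'))%N.
Proof.
move=> uA; rewrite -{1}sum1_count big_mkcond big_distrl /=.
apply: eq_big_seq => l lA; case: ifP => Pl /=; last by rewrite big1 // mul0n.
rewrite mul1n -sum1_count big_mkcond (bigD1_seq l) //= Pl add1n /=.
by apply: eq_bigr => l' _; case: (P l').
Qed.

(* Double counting: each ordered pair of distinct lines meets in exactly one point. *)
Lemma sum_pairs_points A : distinct_lines A ->
  exists r : seq vec3, [/\ uniq r,
    forall p, p \in r -> normalized p,
    forall p, normalized p -> (2 <= pt_mult A p)%N -> p \in r &
    (\sum_(p <- r) pt_mult A p * (pt_mult A p).-1 = size A * (size A).-1)%N].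
Proof.
move=> arrA; have [uA nz np] := arrA.
have [meet meetP] := functional_choice _ (fun ll => meets_exists ll.1 ll.2).
(* The diagonal pairs may add points lying on a single line; these contribute 0 to the sum. *)
pose r := undup [seq meet (l, l') | l <- A, l' <- A].
have rn p : p \in r -> normalized p.
  by rewrite mem_undup => /allpairsP[[l l'] /= [_ _ ->]]; have [] := meetP (l, l').
have meet_r l l' p : l \in A -> l' \in A -> l != l' -> meets l l' p -> p \in r.
  move=> lA l'A ll' mp; rewrite mem_undup; apply/allpairsP; exists (l, l'); split=> //=.
  exact: (distinct_lines_meet arrA lA l'A ll' mp (meetP (l, l'))).
exists r; split=> [|p /rn //|p np2 p2|]; first exact: undup_uniq.
  have [l [l' [lA l'A ll' lp l'p]]] : exists l l', [/\ l \in A, l' \in A, l != l',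
      on_line l p & on_line l' p].
    move: p2; rewrite /pt_mult -size_filter.
    have := filter_uniq (on_line^~ p) uA.
    have := @mem_filter _ (on_line^~ p)^~ A.
    case: (filter _ A) => [|l [|l' t]] //= memA /andP[+ _] _.
    rewrite inE negb_or => /andP[ll' _]; exists l, l'.
    have /= := memA l; have /= := memA l'; rewrite !inE !eqxx orbT /=.
    by move=> /esym /andP[-> ->] /esym /andP[-> ->].
  by apply: (meet_r l l' p lA l'A ll'); split.
under eq_bigr do rewrite /pt_mult count_pairs //.
transitivity (\sum_(l <- A) (size A).-1)%N; last first.
  by rewrite big_const_seq count_predT iter_addn addn0 mulnC.
rewrite exchange_big /=; apply: eq_big_seq => l lA; rewrite exchange_big /=.
have -> : (size A).-1 = (\sum_(l' <- A | l' != l) 1)%N.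
  by rewrite -sum1_size (bigD1_seq l).
rewrite big_seq_cond [RHS]big_seq_cond; apply: eq_bigr => l' /andP[l'A l'l].
have ll' : l != l' by rewrite eq_sym.
have mr : meet (l, l') \in r by exact: meet_r (meetP (l, l')).
transitivity (count (fun p => on_line l p && on_line l' p) r).
  by rewrite -sum1_count [RHS]big_mkcond; apply: eq_bigr => p _; case: ifP.
rewrite (@eq_in_count _ _ (pred1 (meet (l, l')))); last first.
  move=> p pr /=; apply/idP/eqP => [/andP[lp l'p]|->].
    have mp : meets l l' p by split; [exact: rn | exact: lp | exact: l'p].
    exact: (distinct_lines_meet arrA lA l'A ll' mp (meetP (l, l'))).
  by have [_ -> ->] := meetP (l, l').
by rewrite count_uniq_mem ?undup_uniq // mr.
Qed.

Lemma num_pointsP (r : seq vec3) (P : vec3 -> Prop) (Pb : pred vec3) :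
    uniq r -> (forall p, Pb p -> normalized p -> p \in r) ->
    {in r, forall p, normalized p} -> (forall p, reflect (P p) (Pb p)) ->
  num_points P (count Pb r).
Proof.
move=> ur mem_r nr PbP; exists (filter Pb r); split; first exact: filter_uniq.
split=> [|p]; first by rewrite size_filter.
rewrite mem_filter; split=> [/andP[/PbP Pp /nr]|[np_ /PbP Pp]] //.
by rewrite Pp mem_r.
Qed.

Lemma num_points_uniq (P P' : vec3 -> Prop) m n :
  (forall p, normalized p -> P p <-> P' p) -> num_points P m -> num_points P' n -> m = n.
Proof.
move=> PP' [r [ur [<- rP]]] [r' [ur' [<- r'P]]].
apply: perm_size; apply: uniq_perm => // p.
apply/idP/idP => [/rP|/r'P] [np_ Pp].
  by apply/r'P; split=> //; exact: (PP' p np_).1.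
by apply/rP; split=> //; exact: (PP' p np_).2.
Qed.

Lemma pt_mult_rcons ls L p : pt_mult (rcons ls L) p = (pt_mult ls p + on_line L p)%N.
Proof. by rewrite /pt_mult -cats1 count_cat /= addn0. Qed.

(** * Multiple points of the enlarged arrangement *)

Section AddedLine.

Variables (ls : seq vec3) (L : vec3).
Hypothesis lines : distinct_lines (rcons ls L).
Hypothesis nodal_ls : nodal ls.

Let A := rcons ls L.

Lemma added_mult_le3 p : p != 0 -> (pt_mult A p <= 3)%N.
Proof.
by move=> /nodal_ls; rewrite pt_mult_rcons; case: on_line; lia.
Qed.

Lemma triple_points s :
  num_points (fun p => pt_mult ls p = 2%N /\ on_line L p) s ->
  num_points (fun p => pt_mult A p = 3%N) s.
Proof.
case=> r [ur [sr rP]]; exists r; do 2!split=> //; move=> p.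
rewrite rP; split=> -[np_]; rewrite pt_mult_rcons.
  by case=> -> ->.
have := nodal_ls (normalized_neq0 np_).
by case: on_line => le2 e; split=> //; [split|]; lia.
Qed.

(** Among the [d * (d - 1)] ordered pairs of distinct lines, a double point accounts for 2 and a
    triple point for 6; halving gives the formula. *)
Lemma double_points s :
    num_points (fun p => pt_mult ls p = 2%N /\ on_line L p) s ->
  exists n2, num_points (fun p => pt_mult A p = 2%N) n2 /\
             (n2 + 3 * s = 'C((size ls).+1, 2))%N.
Proof.
move=> /triple_points num3; have [r [ur nr mr sum_r]] := sum_pairs_points lines.
have numk k : (2 <= k)%N ->
    num_points (fun p => pt_mult A p = k) (count (fun p => pt_mult A p == k) r).
  move=> k2; apply: num_pointsP => [//|p /eqP e np_|p /nr //|p]; last exact: eqP.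
  by apply: mr; rewrite // -/A e.
exists (count (fun p => pt_mult A p == 2%N) r); split; first exact: numk.
rewrite -(num_points_uniq _ (numk 3%N isT) num3) //.
have : (2 * (count (fun p => pt_mult A p == 2) r + 3 * count (fun p => pt_mult A p == 3) r)
  = 2 * 'C((size ls).+1, 2))%N; last by lia.
rewrite -(size_rcons ls L) -/A bin2.
have -> : (2 * (size A * (size A).-1)./2 = size A * (size A).-1)%N.
  rewrite mul2n halfK; case: (size A) => // n /=.
  by rewrite oddM /= andNb subn0.
have le3 : all (fun p => pt_mult A p <= 3)%N r.
  by apply/allP => p /nr /normalized_neq0 /added_mult_le3.
rewrite -sum_r; elim: r {ur nr mr sum_r numk} le3 => [|p r IHr] /=; first by rewrite big_nil.
case/andP=> p3 /IHr IHr'; rewrite big_cons -IHr'.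
by case: (pt_mult A p) p3 => [|[|[|[|]]]] //= _; lia.
Qed.

End AddedLine.

(* Points lying on no line of [ls] are allowed, so that two points can always be found. *)
Definition pencil_cover (ls : seq vec3) (L : vec3) (r : seq vec3) : Prop :=
  [/\ uniq r, (2 <= size r)%N, {in r, forall p, normalized p /\ on_line L p} &
      {in ls, forall l, has (on_line l) r}].

(** * Grouping the lines into pencils centred on the added line *)

Section PencilCover.

Variables (ls : seq vec3) (L : vec3).
Hypothesis lines : distinct_lines (rcons ls L).
Hypothesis nodal_ls : nodal ls.

Let L_in : L \in rcons ls L. Proof. by rewrite mem_rcons mem_head. Qed.
Let ls_in l : l \in ls -> l \in rcons ls L.
Proof. by rewrite mem_rcons inE => ->; rewrite orbT. Qed.
Let L_notin : L \notin ls.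
Proof. by have [] := lines; rewrite rcons_uniq => /andP[]. Qed.

Lemma axis_neq l : l \in ls -> l != L.
Proof. by move=> lls; apply: contraNneq L_notin => <-. Qed.

Lemma axis_point_unique l p q : l \in ls -> normalized p -> normalized q ->
  on_line L p -> on_line L q -> on_line l p -> on_line l q -> p = q.
Proof.
move=> lls np nq Lp Lq lp lq.
apply: (distinct_lines_meet lines (ls_in lls) L_in (axis_neq lls)); by split.
Qed.

Lemma count_axis_points (r : seq vec3) l : uniq r ->
  {in r, forall p, normalized p /\ on_line L p} -> l \in ls ->
  (count (on_line l) r = has (on_line l) r)%N.
Proof.
move=> ur rP lls; have [/hasP[p pr lp]|] := boolP (has _ _); last first.
  by rewrite has_count -leqNgt leqn0 => /eqP.
have [np Lp] := rP p pr.
rewrite (@eq_in_count _ _ (pred1 p)) ?count_uniq_mem ?pr // => q qr /=.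
have [nq Lq] := rP q qr; apply/idP/eqP => [lq|-> //].
exact: (axis_point_unique lls nq np Lq Lp lq lp).
Qed.

Lemma sum_mult_axis (r : seq vec3) : uniq r ->
    {in r, forall p, normalized p /\ on_line L p} ->
  (\sum_(p <- r) pt_mult ls p = count (fun l => has (on_line l) r) ls)%N.
Proof.
move=> ur rP; rewrite sum_count -sum1_count [RHS]big_mkcond /=.
by apply: eq_big_seq => l lls; rewrite count_axis_points //; case: has.
Qed.

Lemma sum_mult_cover r : pencil_cover ls L r ->
  (\sum_(p <- r) pt_mult ls p = size ls)%N.
Proof.
case=> ur _ rP cov; rewrite sum_mult_axis //; apply/eqP.
by rewrite -all_count; apply/allP => l /cov.
Qed.

Section DoublePoints.

Variable s : nat.
Hypothesis num_s : num_points (fun p => pt_mult ls p = 2%N /\ on_line L p) s.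

Lemma axis_double_le : (2 * s <= size ls)%N.
Proof.
have [r [ur [<- rP]]] := num_s.
have rN : {in r, forall p, normalized p /\ on_line L p} by move=> p /rP [np [_ Lp]].
suff -> : (2 * size r = \sum_(p <- r) pt_mult ls p)%N.
  by rewrite sum_mult_axis // count_size.
rewrite -sum1_size big_distrr /=; apply: eq_big_seq => p /rP [_ [-> _]].
by rewrite muln1.
Qed.

(** A line of [ls] passes through at most one of the points, so the [s] double points involve
    [2 * s] different lines, which are all of them. *)
Lemma pencil_cover_doubles : (2 <= s)%N -> size ls = (2 * s)%N ->
  exists r, [/\ pencil_cover ls L r, size r = s & {in r, forall p, pt_mult ls p = 2%N}].
Proof.
have [r [ur [<- rP]]] := num_s => s2 size_ls.
have rN : {in r, forall p, normalized p /\ on_line L p} by move=> p /rP [np [_ Lp]].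
exists r; split=> [||p /rP [_ []]//] //; split=> // l lls.
have : all (fun l => has (on_line l) r) ls.
  rewrite all_count -sum_mult_axis // size_ls -sum1_size big_distrr /=.
  by apply/eqP; apply: eq_big_seq => p /rP [_ [-> _]]; rewrite muln1.
by move/allP; apply.
Qed.

Lemma pencil_cover_exists :
  exists r, pencil_cover ls L r /\ count (fun p => pt_mult ls p == 2%N) r = s.
Proof.
have [meet meetP] := functional_choice _ (meets_exists L).
(* Two auxiliary points of [L], the second on a coordinate line that misses the first. Two lines of
   [ls] meeting on [L] would otherwise give a single pencil. *)
have [p0 [np0 Lp0 _]] := meets_exists L L.
have [i p0i] : exists i, p0 ord0 i != 0 by apply/rV0Pn/normalized_neq0.
pose e : vec3 := delta_mx ord0 i.
have ep0 : ~~ on_line e p0.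
  rewrite on_lineE /dot (bigD1 i) //= big1 => [|j /negPf ji].
    by rewrite mxE !eqxx addr0 mul1r.
  by rewrite mxE ji andbF mul0r.
have [p1 [np1 Lp1 ep1]] := meets_exists L e.
have p01 : p0 != p1 by apply: contraNneq ep0 => ->.
pose r := undup [:: p0, p1 & map meet ls].
have rN : {in r, forall p, normalized p /\ on_line L p}.
  move=> p; rewrite mem_undup !inE => /or3P[/eqP->|/eqP->|/mapP[l _ ->]] //.
  by have [] := meetP l.
have cov : {in ls, forall l, has (on_line l) r}.
  move=> l lls; apply/hasP; exists (meet l); last by have [] := meetP l.
  by rewrite mem_undup !inE map_f ?orbT.
exists r; split.
  split=> //; first exact: undup_uniq.
  apply: (@uniq_leq_size _ [:: p0; p1]); first by rewrite /= inE p01.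
  by move=> p; rewrite mem_undup !inE => /orP[] ->; rewrite ?orbT.
apply: (num_points_uniq (P := fun p => pt_mult ls p = 2%N /\ on_line L p)) num_s => //.
exists (filter (fun p => pt_mult ls p == 2%N) r); split.
  by rewrite filter_uniq ?undup_uniq.
split=> [|p]; first by rewrite size_filter.
rewrite mem_filter; split=> [/andP[/eqP p2 pr]|[np_ [p2 Lp]]].
  by have [np_ Lp] := rN p pr.
apply/andP; split; first exact/eqP.
have [l lls lp] : exists2 l, l \in ls & on_line l p.
  by apply/hasP; rewrite has_count -/(pt_mult ls p) p2.
have [q qr lq] := hasP (cov l lls); have [nq Lq] := rN q qr.
by rewrite (axis_point_unique lls np_ nq Lp Lq lp lq).
Qed.

End DoublePoints.
End PencilCover.

(** * Derivations *)

Definition vderiv (v : 'I_3 -> S) (p : S) : S := \sum_(i < 3) v i * mderiv i p.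
Definition cst (p : vec3) (i : 'I_3) : S := (p ord0 i)%:MP.
Definition euler (i : 'I_3) : S := 'X_i.

Lemma syzE f v : syz f v = (vderiv v f = 0). Proof. by []. Qed.

Lemma vderivM v p q : vderiv v (p * q) = vderiv v p * q + p * vderiv v q.
Proof.
rewrite /vderiv mulr_suml mulr_sumr -big_split; apply: eq_bigr => i _.
by rewrite mderivM /=; ring.
Qed.

Lemma vderiv_linform v l : vderiv v (linform l) = dotS l v.
Proof. by apply: eq_bigr => i _; rewrite mderiv_linform mulrC mul_mpolyC. Qed.

Lemma vderiv1 v : vderiv v 1 = 0.
Proof. by rewrite /vderiv big1 // => i _; rewrite -mpolyC1 mderivC mulr0. Qed.

Lemma vderiv_addl v w p : vderiv (fun i => v i + w i) p = vderiv v p + vderiv w p.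
Proof. by rewrite /vderiv -big_split; apply: eq_bigr => i _; rewrite mulrDl. Qed.

Lemma vderiv_mull h v p : vderiv (fun i => h * v i) p = h * vderiv v p.
Proof. by rewrite /vderiv mulr_sumr; apply: eq_bigr => i _; rewrite mulrA. Qed.

Lemma vderiv_suml (T : finType) (h : T -> S) (v : T -> 'I_3 -> S) p :
  vderiv (fun i => \sum_t h t * v t i) p = \sum_t h t * vderiv (v t) p.
Proof.
rewrite /vderiv; under eq_bigr do rewrite mulr_suml.
rewrite exchange_big /=; apply: eq_bigr => t _; rewrite mulr_sumr.
by apply: eq_bigr => i _; rewrite mulrA.
Qed.

Lemma eq_vderiv v w p : v =1 w -> vderiv v p = vderiv w p.
Proof. by move=> e; apply: eq_bigr => i _; rewrite e. Qed.

Lemma vderiv_prod0 (T : eqType) (s : seq T) (P : pred T) (F : T -> S) v :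
  {in s, forall t, P t -> vderiv v (F t) = 0} -> vderiv v (\prod_(t <- s | P t) F t) = 0.
Proof.
move=> kill; rewrite big_seq_cond.
apply: (big_ind (fun p => vderiv v p = 0)); first exact: vderiv1.
  by move=> p q p0 q0; rewrite vderivM p0 q0 mul0r mulr0 addr0.
by move=> t /andP[ts Pt]; apply: kill.
Qed.

Lemma dotS_suml (T : finType) l (h : T -> S) (v : T -> 'I_3 -> S) :
  dotS l (fun i => \sum_t h t * v t i) = \sum_t h t * dotS l (v t).
Proof.
rewrite /dotS; under eq_bigr do rewrite scaler_sumr.
rewrite exchange_big /=; apply: eq_bigr => t _; rewrite mulr_sumr.
by apply: eq_bigr => i _; rewrite scalerAr.
Qed.

Lemma vderiv_euler s : vderiv euler (arr_poly s) = (size s)%:R * arr_poly s.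
Proof.
elim: s => [|l s IHs]; first by rewrite /arr_poly big_nil vderiv1 mul0r.
rewrite /arr_poly big_cons -/(arr_poly s) vderivM vderiv_linform IHs.
rewrite -/(dotS l euler) -linformE /= [(size s).+1%:R]mulrSr.
by move: (linform l) (arr_poly s) => p q; ring.
Qed.

Lemma mpolyC_unit (c : K) : c != 0 -> (c%:MP : S) \is a GRing.unit.
Proof. by move=> c0; apply/unitrPr; exists (c^-1)%:MP; rewrite -mpolyCM divff. Qed.

(** The second clause covers degree 0, where [d.-1] is truncated. *)
Lemma mderiv_homog (q : S) d j :
  q \is d.-homog -> mderiv j q \is d.-1.-homog /\ (d = 0%N -> mderiv j q = 0).
Proof.
move=> hq; have supp0 m : m \in msupp q -> d = 0%N -> m j = 0%N.
  move=> mq d0; have /= := dhomog_mf hq mq; rewrite d0 => /eqP.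
  by rewrite mdeg_eq0 => /eqP ->; rewrite mnm0E.
rewrite [mderiv j q](_ : _ = \sum_(m <- msupp q) q@_m *: mderiv j 'X_[m]); last first.
  by rewrite {1}[q]mpolyE raddf_sum; apply: eq_bigr => m _; rewrite /= mderivZ.
split=> [|d0]; last first.
  rewrite big_seq big1 // => m /supp0 mj.
  by rewrite mderivX mj // scale0r scaler0.
rewrite big_seq; apply: rpred_sum => m mq; apply: rpredZ; rewrite mderivX.
have [->|mj] := eqVneq (m j) 0%N; first by rewrite scale0r rpred0.
apply: rpredZ; rewrite dhomogX /=; have /= <- := dhomog_mf hq mq.
have e : (m - U_(j) + U_(j) = m)%MM by rewrite submK ?lep1mP.
by rewrite -{2}e mdegD mdeg1 addn1.
Qed.

Lemma homog_vderiv_euler (p : vec3) (q : S) d i :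
  q \is d.-homog -> vderiv (cst p) q * 'X_i \is d.-homog.
Proof.
move=> hq; rewrite /vderiv mulr_suml; apply: rpred_sum => j _.
rewrite -mulrA /cst mul_mpolyC; apply: rpredZ.
case: d hq => [|d] hq; have [hq1 hq0] := mderiv_homog j hq.
  by rewrite hq0 // mul0r rpred0.
by rewrite -(addn1 d); apply: dhomogM; rewrite // dhomogX /= mdeg1.
Qed.

Lemma arr_poly_homog s : arr_poly s \is (size s).-homog.
Proof.
rewrite /arr_poly; elim: s => [|l s IHs]; first by rewrite big_nil dhomog1.
by rewrite big_cons /= -(add1n (size s)); apply: dhomogM IHs; apply: linform_homog.
Qed.

(** * The resolution *)

(** Indices are given by their values, which avoids a cast between ['I_m] and ['I_(m - 2).+2]. *)
Lemma sum_ord_split2 (V : nmodType) n k (j0 j1 : 'I_n) (sh : 'I_k -> 'I_n) (F : 'I_n -> V) :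
    n = k.+2 -> j0 = 0%N :> nat -> j1 = 1%N :> nat -> (forall i, sh i = i.+2 :> nat) ->
  \sum_j F j = F j0 + F j1 + \sum_i F (sh i).
Proof.
move=> e; subst n => e0 e1 esh; rewrite !big_ord_recl addrA.
congr (F _ + F _ + _); [exact: val_inj | exact: val_inj |].
by apply: eq_bigr => i _; congr F; apply: val_inj; rewrite /= esh.
Qed.

Section Resolution.

Variables (ls : seq vec3) (L : vec3) (r : seq vec3).
Hypothesis lines : distinct_lines (rcons ls L).
Hypothesis nodal_ls : nodal ls.
Hypothesis cover : pencil_cover ls L r.

Local Notation m := (size r).
Local Notation d := (size ls).+1.
Local Notation f := (arr_poly (rcons ls L)).

Definition axis_pt (j : 'I_m) : vec3 := nth 0 r j.
Local Notation P := axis_pt.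

Definition pencil (j : 'I_m) : S := \prod_(l <- ls | on_line l (P j)) linform l.
Definition copencil (j : 'I_m) : S := \prod_(i < m | i != j) pencil i.
Local Notation Q := pencil.
Local Notation G := copencil.

Lemma axis_pt_mem j : P j \in r. Proof. exact: mem_nth. Qed.

Lemma axis_pt_inj : injective P.
Proof.
have [ur _ _ _] := cover.
by move=> i j /eqP; rewrite nth_uniq // => /eqP/val_inj.
Qed.

Lemma axis_pt_normalized j : normalized (P j).
Proof. by have [_ _ rP _] := cover; have [] := rP _ (axis_pt_mem j). Qed.

Lemma axis_pt_dot j : dot L (P j) = 0.
Proof. by have [_ _ rP _] := cover; have [_ /eqP] := rP _ (axis_pt_mem j). Qed.

Lemma axis_pt_on j : on_line L (P j).
Proof. by rewrite on_lineE axis_pt_dot. Qed.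

Let ls_in l : l \in ls -> l \in rcons ls L.
Proof. by rewrite mem_rcons inE => ->; rewrite orbT. Qed.

Lemma axis_neq0 : L != 0.
Proof. by have [_ nz _] := lines; apply: nz; rewrite mem_rcons mem_head. Qed.

Lemma cover_line l : l \in ls -> exists j, forall j', on_line l (P j') = (j' == j).
Proof.
move=> lls; have [_ _ rP cov] := cover; have [p pr lp] := hasP (cov l lls).
have ip : (index p r < m)%N by rewrite index_mem.
exists (Ordinal ip) => j'; apply/idP/eqP => [lj'|->]; last by rewrite /P nth_index.
have [np Lp] := rP p pr; apply: val_inj => /=.
have [ur _ _ _] := cover.
by rewrite -(axis_point_unique lines lls (axis_pt_normalized j') np (axis_pt_on j') Lp lj' lp)
  index_uniq.
Qed.

Lemma pencil_prod : arr_poly ls = \prod_j Q j.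
Proof.
under eq_bigr do rewrite /Q big_mkcond.
rewrite exchange_big /=; apply: eq_big_seq => l /cover_line [j lj].
by rewrite -big_mkcond (eq_bigl _ _ lj) big_pred1_eq.
Qed.

Lemma pencil_copencil j : Q j * G j = arr_poly ls.
Proof. by rewrite pencil_prod [RHS](bigD1 j). Qed.

Lemma linform_pencil_neq0 l : l \in ls -> linform l != 0.
Proof. by have [_ nz _] := lines; rewrite linform_eq0 => /ls_in /nz. Qed.

Lemma pencil_neq0 j : Q j != 0.
Proof.
rewrite /Q big_seq_cond; apply: (big_ind (fun p => p != 0)); first exact: oner_neq0.
  by move=> p q; apply: mulf_neq0.
by move=> l /andP[/linform_pencil_neq0].
Qed.

Lemma arr_poly_neq0 : f != 0.
Proof.
rewrite /arr_poly big_seq; apply: (big_ind (fun p => p != 0)); first exact: oner_neq0.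
  by move=> p q; apply: mulf_neq0.
by have [_ nz _] := lines => l /nz; rewrite linform_eq0.
Qed.

Lemma pencil_homog j : Q j \is (pt_mult ls (P j)).-homog.
Proof.
rewrite /Q /pt_mult; elim: ls => [|l s IHs]; first by rewrite big_nil dhomog1.
rewrite big_cons /=; case: ifP => _ //; apply: dhomogM IHs; exact: linform_homog.
Qed.

Lemma copencil_homog j : G j \is (size ls - pt_mult ls (P j))%N.-homog.
Proof.
have -> : (size ls - pt_mult ls (P j) = \sum_(i < m | i != j) pt_mult ls (P i))%N.
  rewrite -(sum_mult_cover lines cover) (big_nth 0) big_mkord (bigD1 j) //=.
  by rewrite addKn.
rewrite /G; apply: (big_rec2 (fun q n => q \is n.-homog)); first exact: dhomog1.
by move=> i q n _; apply: dhomogM; apply: pencil_homog.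
Qed.

Lemma regular_lines l l' : l \in rcons ls L -> l' \in rcons ls L -> l != l' ->
  regular_mod (linform l) (linform l').
Proof.
have [_ nz np] := lines => lA l'A ll'.
by apply: regular_linform; [exact: nz | exact: np].
Qed.

(** This is where nodality enters: a common zero would be a point of multiplicity at least 3. *)
Lemma regular2_lines l a b : l \in ls -> a \in ls -> b \in ls ->
  l != a -> l != b -> a != b -> regular_mod2 (linform l) (linform a) (linform b).
Proof.
move=> lls als bls la lb ab; apply: regular2_linform => p /nodal_ls; apply: contraL.
case/and3P=> lp ap bp; rewrite -ltnNge /pt_mult -size_filter.
apply: (@uniq_leq_size _ [:: l; a; b]); first by rewrite /= !inE negb_or la lb ab.
by move=> x; rewrite !inE mem_filter => /or3P[] /eqP ->; apply/andP.
Qed.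

Lemma pencil_lines_neq i j l l' : i != j -> l \in ls ->
  on_line l (P i) -> on_line l' (P j) -> l != l'.
Proof.
move=> ij /cover_line [k lk]; rewrite lk => /eqP ik l'j.
by apply: contraNneq ij => ll'; move: l'j; rewrite -ll' lk ik eq_sym.
Qed.

Lemma regular_pencil i j : i != j -> regular_mod (Q i) (Q j).
Proof.
move=> ij; apply: regular_mod_prodl => l lls li; apply: regular_mod_prodr => l' l'ls l'j.
split; first exact: linform_pencil_neq0.
by apply: regular_lines; rewrite ?ls_in //; apply: (pencil_lines_neq ij).
Qed.

Lemma regular2_pencil i j k : i != j -> i != k -> j != k ->
  regular_mod2 (Q i) (Q j) (Q k).
Proof.
move=> ij ik jk; apply: regular_mod2_prodl => l lls li.
apply: regular_mod2_prodm => a als aj; split; last first.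
  apply: regular_mod_prodr => b bls bk; split; first exact: linform_pencil_neq0.
  by apply: regular_lines; rewrite ?ls_in //; apply: (pencil_lines_neq jk).
apply: regular_mod2C; apply: regular_mod2_prodm => b bls bk; split.
  apply: regular2_lines => //.
  - exact: (pencil_lines_neq ik).
  - exact: (pencil_lines_neq ij).
  by rewrite eq_sym; exact: (pencil_lines_neq jk).
apply: regular_lines; rewrite ?ls_in // eq_sym.
exact: (pencil_lines_neq jk).
Qed.

Lemma cover_gt0 : (0 < m)%N. Proof. by have [_ /ltnW] := cover. Qed.
Lemma cover_gt1 : (1 < m)%N. Proof. by have [] := cover. Qed.

Let j0 : 'I_m := Ordinal cover_gt0.
Let j1 : 'I_m := Ordinal cover_gt1.

Lemma shift2_subproof (i : 'I_(m - 2)) : (i.+2 < m)%N.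
Proof. have := ltn_ord i; lia. Qed.
Definition shift2 (i : 'I_(m - 2)) : 'I_m := Ordinal (shift2_subproof i).

Lemma shift2_inj : injective shift2.
Proof. by move=> i j /(congr1 val) /= [] /val_inj. Qed.

Lemma sum_cover (V : nmodType) (F : 'I_m -> V) :
  \sum_j F j = F j0 + F j1 + \sum_i F (shift2 i).
Proof.
by apply: sum_ord_split2 => //; have := cover_gt1; lia.
Qed.

Lemma cover_ordP (j : 'I_m) : [\/ j = j0, j = j1 | exists i, j = shift2 i].
Proof.
case: j => [[|[|k]] km]; [constructor 1 | constructor 2 | constructor 3];
  try exact: val_inj.
have km' : (k < m - 2)%N by move: km; lia.
by exists (Ordinal km'); apply: val_inj.
Qed.

Let UV_indep : forall x y : K, x *: P j0 + y *: P j1 = 0 -> x = 0 /\ y = 0.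
Proof.
apply: normalized_indep; try exact: axis_pt_normalized.
by rewrite (inj_eq axis_pt_inj).
Qed.

(** [fa] and [fb] read off coordinates in the plane [L = 0] with respect to [P j0] and [P j1]. The
    vectors are supplied by [plane_frame] once the section is closed. *)
Variables fa fb fw : vec3.
Hypothesis frame : forall i j, (i == j)%:R =
  P j0 ord0 i * fa ord0 j + P j1 ord0 i * fb ord0 j + fw ord0 i * L ord0 j.

Let ca (j : 'I_m) : K := dot fa (P j).
Let cb (j : 'I_m) : K := dot fb (P j).

Lemma frame_const p : dot L p = 0 -> p = dot fa p *: P j0 + dot fb p *: P j1.
Proof.
move=> Lp; apply/rowP => i; rewrite !mxE.
transitivity (\sum_j (i == j)%:R * p ord0 j).
  rewrite (bigD1 i) //= eqxx mul1r big1 ?addr0 // => j.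
  by rewrite eq_sym => /negPf ->; rewrite mul0r.
transitivity (dot fa p * P j0 ord0 i + dot fb p * P j1 ord0 i + dot L p * fw ord0 i).
  rewrite /dot !mulr_suml -!big_split; apply: eq_bigr => j _.
  by rewrite frame /=; ring.
by rewrite Lp mul0r addr0.
Qed.

Lemma frame_poly v : dotS L v = 0 ->
  forall i, v i = cst (P j0) i * dotS fa v + cst (P j1) i * dotS fb v.
Proof.
move=> Lv i; rewrite /cst !mul_mpolyC.
transitivity (\sum_j (i == j)%:R *: v j).
  rewrite (bigD1 i) //= eqxx scale1r big1 ?addr0 // => j.
  by rewrite eq_sym => /negPf ->; rewrite scale0r.
transitivity (P j0 ord0 i *: dotS fa v + P j1 ord0 i *: dotS fb v + fw ord0 i *: dotS L v).
  rewrite /dotS !scaler_sumr -!big_split; apply: eq_bigr => j _.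
  by rewrite frame /= !scalerDl !scalerA.
by rewrite Lv scaler0 addr0.
Qed.

Lemma axis_pt_coord j : P j = ca j *: P j0 + cb j *: P j1.
Proof. exact: frame_const (axis_pt_dot j). Qed.

Let coord0 : ca j0 = 1 /\ cb j0 = 0.
Proof.
have [|/eqP] := @UV_indep (ca j0 - 1) (cb j0); last by rewrite subr_eq0 => /eqP.
by rewrite scalerBl scale1r addrAC -axis_pt_coord subrr.
Qed.

Let coord1 : ca j1 = 0 /\ cb j1 = 1.
Proof.
have [|-> /eqP] := @UV_indep (ca j1) (cb j1 - 1); last by rewrite subr_eq0 => /eqP.
by rewrite scalerBl scale1r addrA -axis_pt_coord subrr.
Qed.

Lemma coord_det i j : i != j -> ca i * cb j - ca j * cb i != 0.
Proof.
move=> ij; apply/eqP => det0.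
have ind : forall x y : K, x *: P i + y *: P j = 0 -> x = 0 /\ y = 0.
  apply: normalized_indep; try exact: axis_pt_normalized.
  by rewrite (inj_eq axis_pt_inj).
have expand x y : x *: P i + y *: P j =
    (x * ca i + y * ca j) *: P j0 + (x * cb i + y * cb j) *: P j1.
  rewrite (axis_pt_coord i) (axis_pt_coord j) !scalerDr !scalerDl !scalerA.
  by rewrite addrACA.
have [|b0 _] := ind (cb j) (- cb i).
  rewrite expand (_ : cb j * ca i + - cb i * ca j = 0); last by rewrite -det0; ring.
  by rewrite (_ : cb j * cb i + - cb i * cb j = 0) ?scale0r ?addr0 //; ring.
have [|a0 _] := ind (ca j) (- ca i).
  rewrite expand (_ : ca j * cb i + - ca i * cb j = 0); last first.
    by rewrite -oppr0 -det0; ring.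
  by rewrite (_ : ca j * ca i + - ca i * ca j = 0) ?scale0r ?addr0 //; ring.
move: (normalized_neq0 (axis_pt_normalized j)).
by rewrite axis_pt_coord a0 b0 !scale0r addr0 eqxx.
Qed.

Let a (j : 'I_m) : S := (ca j)%:MP.
Let b (j : 'I_m) : S := (cb j)%:MP.

Let det_unit i j : i != j -> a i * b j - a j * b i \is a GRing.unit.
Proof.
by move=> ij; rewrite /a /b -!mpolyCM -mpolyCB; apply: mpolyC_unit; apply: coord_det.
Qed.

Let dinv : S := (d%:R^-1)%:MP.

Let dinvK : dinv * d%:R = 1.
Proof. by rewrite /dinv -mpolyC_nat -mpolyCM mulVf ?mpolyC1 // natr_neq0. Qed.

(* The field [G j * P j], corrected by a multiple of the Euler field so as to kill [f]. *)
Definition gen (j : 'I_m) (i : 'I_3) : S :=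
  G j * cst (P j) i + - (dinv * vderiv (cst (P j)) (G j)) * 'X_i.

Lemma arr_poly_rcons : f = linform L * arr_poly ls.
Proof. by rewrite /arr_poly -cats1 big_cat big_seq1 mulrC. Qed.

Lemma vderiv_euler_arr : vderiv euler f = d%:R * f.
Proof. by rewrite vderiv_euler size_rcons. Qed.

Lemma vderiv_axis : forall j, vderiv (cst (P j)) (linform L) = 0.
Proof. by move=> j; rewrite vderiv_linform dotSC axis_pt_dot mpolyC0. Qed.

Lemma vderiv_pencil j : vderiv (cst (P j)) (Q j) = 0.
Proof.
apply: vderiv_prod0 => l _; rewrite on_lineE => /eqP lj.
by rewrite vderiv_linform dotSC lj mpolyC0.
Qed.

(** The constant field [P j] kills [linform L] and [Q j], so [G j * P j] multiplies [f] by the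
    derivative of [G j] along [P j]. The Euler field multiplies [f] by [d], hence the factor
    [dinv]. *)
Lemma gen_syz j : syz f (gen j).
Proof.
rewrite syzE /gen vderiv_addl !vderiv_mull -/euler vderiv_euler_arr.
rewrite arr_poly_rcons -(pencil_copencil j) !vderivM vderiv_axis vderiv_pencil.
have key (D l q g x y : S) : x * y = 1 ->
    g * (0 * (q * g) + l * (0 * g + q * D)) + - (x * D) * (y * (l * (q * g))) = 0.
  move=> xy; transitivity (l * q * g * D * (1 - x * y)); first by ring.
  by rewrite xy subrr mulr0.
exact: key dinvK.
Qed.

Lemma gen_homog j : homog3 (size ls - pt_mult ls (P j))%N (gen j).
Proof.
move=> i; apply: rpredD.
  by rewrite /cst mulrC mul_mpolyC; apply/rpredZ/copencil_homog.
rewrite mulNr rpredN -mulrA mul_mpolyC; apply: rpredZ.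
by apply: homog_vderiv_euler; apply: copencil_homog.
Qed.

Lemma dotS_gen j : dotS L (gen j) = - (dinv * vderiv (cst (P j)) (G j)) * linform L.
Proof.
by rewrite /gen dotSD !dotSM dotSC axis_pt_dot mpolyC0 mulr0 add0r.
Qed.

Lemma cst_axis j i : cst (P j) i = cst (P j0) i * a j + cst (P j1) i * b j.
Proof.
rewrite /cst /a /b {1}axis_pt_coord !mxE mpolyCD !mpolyCM.
by rewrite ![_%:MP * (P _ _ _)%:MP]mulrC.
Qed.

(** The Leibniz rule on [f = linform l * R] makes [R * dotS l v] a multiple of [linform l], and [R]
    is regular modulo it. *)
Lemma syz_line_dvd v l : syz f v -> l \in rcons ls L ->
  exists u, dotS l v = linform l * u.
Proof.
rewrite syzE => fv lA; have [uA nz np] := lines.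
pose R := \prod_(l' <- rcons ls L | l' != l) linform l'.
have ef : f = linform l * R by rewrite /arr_poly (bigD1_seq l).
have regR : regular_mod R (linform l).
  by apply: regular_mod_prodl => l' l'A l'l; apply: regular_lines.
apply: (regR _ (- vderiv v R)); rewrite mulrN mulrC; apply/eqP.
by rewrite -addr_eq0 -vderiv_linform -vderivM -ef fv.
Qed.

(** In the plane [L = 0], [l] vanishes at [P j], so its values [lU], [lV] at the basis points are
    proportional to [- cb j], [ca j], and [dotS l u] is a scalar multiple of the form cutting out
    [P j]. One of [lU], [lV] is nonzero, for otherwise [l] would be a multiple of [L]. *)
Lemma axis_form_dvd u j l : dotS L u = 0 -> l \in ls -> on_line l (P j) ->
    (exists w, dotS l u = linform l * w) ->
  exists w, a j * dotS fb u - b j * dotS fa u = linform l * w.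
Proof.
move=> Lu lls lj [w lw].
set al := dotS fa u; set be := dotS fb u.
pose lU := dot l (P j0); pose lV := dot l (P j1).
have luE : lU%:MP * al + lV%:MP * be = linform l * w.
  rewrite -lw -!dotSC -/(dotS l (cst _)) mulrC [_ * be]mulrC -!dotSM -dotSD.
  by apply: eq_dotS => i; rewrite (frame_poly Lu) ![cst _ i * _]mulrC.
have lj0 : a j * lU%:MP + b j * lV%:MP = 0.
  rewrite /a /b -!mpolyCM -mpolyCD -!dotZr -dotDr -axis_pt_coord.
  by move: lj; rewrite on_lineE => /eqP ->; rewrite mpolyC0.
have [lU0|lU0] := eqVneq lU 0; last first.
  exists (lU^-1%:MP * (- b j * w)).
  have uv : lU^-1%:MP * lU%:MP = 1 :> S by rewrite -mpolyCM mulVf ?mpolyC1.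
  transitivity (lU^-1%:MP * (- b j * (linform l * w))); last by ring.
  transitivity (lU^-1%:MP * (- b j * (linform l * w) + be * 0)); last by rewrite mulr0 addr0.
  by rewrite -luE -lj0 -[LHS]mul1r -uv; ring.
have [lV0|lV0] := eqVneq lV 0.
  have UV : P j0 != P j1 by rewrite (inj_eq axis_pt_inj).
  have lU' : on_line l (P j0) by rewrite on_lineE -/lU lU0.
  have lV' : on_line l (P j1) by rewrite on_lineE -/lV lV0.
  have [c e] := line_through (axis_pt_normalized j0) (axis_pt_normalized j1) UV axis_neq0
    (axis_pt_on j0) (axis_pt_on j1) lU' lV'.
  have [_ _ np] := lines; case: (np l L _ _ (axis_neq lines lls) c e).
    exact: ls_in.
  by rewrite mem_rcons mem_head.
exists (lV^-1%:MP * (a j * w)).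
have uv : lV^-1%:MP * lV%:MP = 1 :> S by rewrite -mpolyCM mulVf ?mpolyC1.
transitivity (lV^-1%:MP * (a j * (linform l * w))); last by ring.
transitivity (lV^-1%:MP * (a j * (linform l * w) - al * 0)); last by rewrite mulr0 subr0.
by rewrite -luE -lj0 -[LHS]mul1r -uv; ring.
Qed.

(** Subtracting [rho] times the Euler field makes [v] kill [linform L], and the result [u] is a
    spline to which [spline_generators] applies. Going back to [gen] only changes the multiple of
    the Euler field. *)
Lemma gen_generates : generates f gen.
Proof.
move=> v fv; have fv0 := fv; rewrite syzE in fv0.
have L_in : L \in rcons ls L by rewrite mem_rcons mem_head.
have [rho vL] := syz_line_dvd fv L_in.
pose u i := v i + - rho * 'X_i.
have dotu l : dotS l u = dotS l v + - rho * linform l by rewrite /u dotSD dotSM.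
have Lu : dotS L u = 0 by rewrite dotu vL mulNr mulrC subrr.
have spl : {in index_enum 'I_m, forall j, exists t,
    a j * dotS fb u - b j * dotS fa u = Q j * t}.
  move=> j _; apply: prod_dvd_regular.
  - by have [] := lines; rewrite rcons_uniq => /andP[].
  - by move=> l l' lls l'ls _ _ ll'; apply: regular_lines; rewrite ?ls_in.
  move=> l lls lj; apply: axis_form_dvd => //.
  have [w lw] := syz_line_dvd fv (ls_in lls).
  by exists (w - rho); rewrite dotu lw; ring.
have [||h [ea eb]] := spline_generators det_unit regular_pencil regular2_pencil _ _ spl.
- exact: index_enum_uniq.
- by rewrite -[index_enum _]enumT size_enum_ord cover_gt1.
pose c := rho + \sum_j h j * (dinv * vderiv (cst (P j)) (G j)).
have uE i : u i = \sum_j h j * (G j * cst (P j) i).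
  rewrite (frame_poly Lu) ea eb !mulr_sumr -big_split; apply: eq_bigr => j _.
  by rewrite (cst_axis j) /G /=; ring.
have vE i : v i = \sum_j h j * gen j i + c * 'X_i.
  rewrite /gen; under eq_bigr do rewrite mulrDr.
  rewrite big_split -uE /u /c mulrDl mulr_suml -addrA.
  have -> : \sum_j h j * (- (dinv * vderiv (cst (P j)) (G j)) * 'X_i) =
      - \sum_j h j * (dinv * vderiv (cst (P j)) (G j)) * 'X_i.
    by rewrite -sumrN; apply: eq_bigr => j _; ring.
  by ring.
(* Both [v] and the [gen j] kill [f], so the leftover Euler term gives [c * d * f = 0]. *)
have c0 : c = 0.
  have : vderiv (fun i => \sum_j h j * gen j i + c * euler i) f = 0.
    by rewrite -[RHS]fv0; apply: eq_vderiv => i; rewrite [RHS]vE.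
  rewrite vderiv_addl vderiv_suml vderiv_mull vderiv_euler_arr.
  rewrite big1 ?add0r => [/eqP|j _]; last first.
    by have := gen_syz j; rewrite syzE => ->; rewrite mulr0.
  rewrite mulf_eq0 => /orP[/eqP //|].
  rewrite mulf_eq0 (negPf arr_poly_neq0) orbF => /eqP d0.
  by have := dinvK; rewrite d0 mulr0 => /esym/eqP; rewrite oner_eq0.
by exists h => i; rewrite vE c0 mul0r addr0.
Qed.

(** Pairing with [L] kills the parts along the [P j], so the total Euler coefficient vanishes on its
    own. *)
Lemma gen_relation_split h : (forall i, \sum_j h j * gen j i = 0) ->
  forall i, \sum_j h j * G j * cst (P j) i = 0.
Proof.
move=> h0; have Drel : \sum_j h j * (dinv * vderiv (cst (P j)) (G j)) = 0.
  have : dotS L (fun i => \sum_j h j * gen j i) = 0.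
    by rewrite (eq_dotS L h0) /dotS big1 // => i _; rewrite scaler0.
  rewrite dotS_suml; under eq_bigr do rewrite dotS_gen mulNr mulrN mulrA.
  rewrite sumrN -mulr_suml => /eqP; rewrite oppr_eq0 mulf_eq0 linform_eq0.
  by rewrite (negPf axis_neq0) orbF => /eqP.
move=> i; rewrite -[RHS](h0 i) /gen; under [RHS]eq_bigr do rewrite mulrDr.
rewrite big_split /= [X in _ + X](_ : _ = 0) ?addr0; last first.
  transitivity (- ((\sum_j h j * (dinv * vderiv (cst (P j)) (G j))) * 'X_i)).
    by rewrite mulr_suml -sumrN; apply: eq_bigr => j _; ring.
  by rewrite Drel mul0r oppr0.
by apply: eq_bigr => j _; rewrite mulrA.
Qed.

(** Coefficients of the dependency expressing the point of index [i + 2] through [P j0] and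
    [P j1]. *)
Definition pencil_relc (i : 'I_(m - 2)) (j : 'I_m) : K :=
  (j == shift2 i)%:R - (j == j0)%:R * ca (shift2 i) - (j == j1)%:R * cb (shift2 i).

Definition pencil_rel (i : 'I_(m - 2)) (j : 'I_m) : S := (pencil_relc i j)%:MP * Q j.

Let shift2_neq i : (shift2 i == j0 = false) * (shift2 i == j1 = false).
Proof. by []. Qed.

Lemma relc_shift2 i k : pencil_relc i (shift2 k) = (k == i)%:R.
Proof. by rewrite /pencil_relc !shift2_neq !mul0r !subr0 (inj_eq shift2_inj). Qed.

Lemma relc_axis i l : \sum_j (pencil_relc i j)%:MP * cst (P j) l = 0.
Proof.
have -> : \sum_j (pencil_relc i j)%:MP * cst (P j) l = ((\sum_j pencil_relc i j *: P j) ord0 l)%:MP.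
  rewrite summxE rmorph_sum /=; apply: eq_bigr => j _.
  by rewrite mxE mpolyCM.
rewrite sum_cover (bigD1 i) //= relc_shift2 eqxx scale1r big1 ?addr0; last first.
  by move=> k /negPf ki; rewrite relc_shift2 ki scale0r.
rewrite (axis_pt_coord (shift2 i)) /pencil_relc.
have e0 : (j0 == shift2 i) = false by [].
have e1 : (j1 == shift2 i) = false by [].
have e01 : (j0 == j1) = false by [].
have e10 : (j1 == j0) = false by [].
rewrite !eqxx e0 e1 e01 e10 !mul0r !mul1r !sub0r !subr0 oppr0 sub0r !scaleNr.
by rewrite -opprD addNr mxE mpolyC0.
Qed.

(** Since [P j] kills [Q j], the product [Q j * gen j] is [arr_poly ls * P j] minus [dinv] times the
    derivative of [arr_poly ls] along [P j] times the Euler field. This is linear in [P j], so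
    dependencies of the points become relations. *)
Lemma rel_gen i l : \sum_j pencil_rel i j * gen j l = 0.
Proof.
have termE j : pencil_rel i j * gen j l =
    arr_poly ls * ((pencil_relc i j)%:MP * cst (P j) l)
    + - (dinv * 'X_l) * ((pencil_relc i j)%:MP * vderiv (cst (P j)) (arr_poly ls)).
  by rewrite /pencil_rel /gen -(pencil_copencil j) vderivM vderiv_pencil; ring.
under eq_bigr do rewrite termE.
rewrite big_split -!mulr_sumr /= relc_axis mulr0 add0r -vderiv_suml.
rewrite (@eq_vderiv _ (fun=> 0)) => [|k]; last exact: relc_axis.
by rewrite /vderiv big1 ?mulr0 // => k _; rewrite mul0r.
Qed.

(** On the columns [shift2 k] the relation matrix is diagonal, with the nonzero entries
    [Q (shift2 k)]. *)
Lemma rel_inj (c : 'I_(m - 2) -> S) :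
  (forall j, \sum_i c i * pencil_rel i j = 0) -> forall i, c i = 0.
Proof.
move=> c0 i; have := c0 (shift2 i); rewrite (bigD1 i) //= big1 ?addr0; last first.
  by move=> k /negPf ki; rewrite /pencil_rel relc_shift2 eq_sym ki mpolyC0 mul0r mulr0.
rewrite /pencil_rel relc_shift2 eqxx mpolyC1 mul1r => /eqP.
by rewrite mulf_eq0 (negPf (pencil_neq0 _)) orbF => /eqP.
Qed.

(** [spline_relations] gives [h j = Q j * g j] with the [g j] a dependency of the points. The values
    of [g] at [shift2 i] serve as coefficients, and those at [j0], [j1] are then forced. *)
Lemma rel_generates (h : 'I_m -> S) : (forall l, \sum_j h j * gen j l = 0) ->
  exists c : 'I_(m - 2) -> S, forall j, h j = \sum_i c i * pencil_rel i j.
Proof.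
move/gen_relation_split => rel0.
have form_sum l : \sum_j h j * G j * (dot l (P j))%:MP = 0.
  transitivity (dotS l (fun i => \sum_j h j * G j * cst (P j) i)).
    by rewrite dotS_suml; apply: eq_bigr => j _; rewrite dotSC.
  by rewrite (eq_dotS l rel0) /dotS big1 // => i _; rewrite scaler0.
have [|||g [hE sa sb]] :=
    spline_relations (s := index_enum 'I_m) (h := h) det_unit regular_pencil _ _ _ (form_sum fa) (form_sum fb).
- exact: index_enum_uniq.
- by rewrite -[index_enum _]enumT size_enum_ord cover_gt1.
- by move=> j _; apply: pencil_neq0.
exists (fun i => g (shift2 i)) => j; rewrite hE ?mem_index_enum // mulrC.
rewrite /pencil_rel; under eq_bigr do rewrite mulrA.
rewrite -mulr_suml; congr (_ * _).
have [-> | -> | [k ->]] := cover_ordP j.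
- have e i : pencil_relc i j0 = - ca (shift2 i).
    by rewrite /pencil_relc (_ : (j0 == shift2 i) = false) // eqxx mul1r sub0r mul0r subr0.
  under eq_bigr do rewrite e mpolyCN mulrN.
  apply/eqP; rewrite sumrN -addr_eq0; move: sa; rewrite sum_cover /a coord0.1 coord1.1.
  by rewrite mpolyC0 mpolyC1 mulr1 mulr0 addr0 => ->.
- have e i : pencil_relc i j1 = - cb (shift2 i).
    by rewrite /pencil_relc (_ : (j1 == shift2 i) = false) // eqxx mul1r sub0r mul0r oppr0 add0r.
  under eq_bigr do rewrite e mpolyCN mulrN.
  apply/eqP; rewrite sumrN -addr_eq0; move: sb; rewrite sum_cover /b coord0.2 coord1.2.
  by rewrite mpolyC0 mpolyC1 mulr1 mulr0 add0r => ->.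
rewrite (bigD1 k) //= relc_shift2 eqxx mpolyC1 mulr1 big1 ?addr0 // => i.
by rewrite relc_shift2 eq_sym => /negPf ->; rewrite mpolyC0 mulr0.
Qed.

Lemma pencil_dvd_relation (h : 'I_m -> S) : (forall l, \sum_j h j * gen j l = 0) ->
  forall j, exists u, h j = Q j * u.
Proof.
move=> /rel_generates [c hE] j; exists (\sum_i c i * (pencil_relc i j)%:MP).
by rewrite hE mulr_sumr; apply: eq_bigr => i _; rewrite /pencil_rel; ring.
Qed.

End Resolution.

(** * Graded dimensions *)

Lemma pihomogM_homog (p q : S) a b : q \is b.-homog ->
  pihomog mdeg (a + b) (p * q) = pihomog mdeg a p * q.
Proof.
move=> hq; have [k kp ka] : exists2 k, (msize p <= k)%N & (a < k)%N.
  by exists (maxn (msize p) a.+1); rewrite ?leq_maxl ?leq_maxr.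
have hpi i : pihomog mdeg i p * q \is (i + b).-homog.
  by apply: dhomogM => //; apply: pihomogP.
rewrite {1}(pihomog_partitionE kp) mulr_suml raddf_sum (bigD1 (Ordinal ka)) //=.
rewrite [X in X + _](pihomog_dE (hpi a)) big1 ?addr0 // => i ia.
by apply: pihomog_ne0 (hpi i); rewrite eqn_add2r.
Qed.

(** Exactness over [S] provides arbitrary polynomial coefficients; keeping one homogeneous component
    of each carries it over to a fixed degree. *)
Lemma homog_lift (I J : finType) (A : I -> J -> S) (e : I -> J -> nat)
    (D : I -> nat) (D' : J -> nat) (v : J -> S) (w : I -> S) :
    (forall i j, A i j \is (e i j).-homog) -> (forall i j, D i + e i j = D' j)%N ->
    (forall j, v j \is (D' j).-homog) -> (forall j, v j = \sum_i w i * A i j) ->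
  forall j, v j = \sum_i pihomog mdeg (D i) (w i) * A i j.
Proof.
move=> hA eD hv vE j; rewrite -{1}(pihomog_dE (hv j)) vE raddf_sum /=.
by apply: eq_bigr => i _; rewrite -(eD i j) pihomogM_homog.
Qed.

Local Notation hilb k := 'C(k + 2, k).

(** Linear coordinates on one graded piece of a free module, so that graded maps become matrices and
    dimensions become ranks. *)
Definition graded_frame (I : finType) (D : I -> nat) n (phi : 'rV[K]_n -> I -> S) : Prop :=
  [/\ forall c x y i, phi (c *: x + y) i = c *: phi x i + phi y i,
      forall x, (forall i, phi x i = 0) -> x = 0,
      forall x i, phi x i \is (D i).-homog &
      forall v, (forall i, v i \is (D i).-homog) -> exists x, forall i, phi x i = v i].

Lemma homog_coordinates k : exists phi : 'rV[K]_(hilb k) -> S,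
  [/\ forall c x y, phi (c *: x + y) = c *: phi x + phi y,
      forall x, phi x = 0 -> x = 0,
      forall x, phi x \is k.-homog &
      forall p, p \is k.-homog -> exists x, phi x = p].
Proof.
have [psi psi_lin [inv psiK invK]] := @dhomog_vecaxiom 2 K k.
exists (fun x => mpoly_of_dhomog (inv x)); split.
- move=> c x y; rewrite (_ : inv (c *: x + y) = c *: inv x + inv y) //.
  by apply: (can_inj psiK); rewrite psi_lin !invK.
- move=> x x0; rewrite -[x]invK (_ : inv x = 0); last exact: val_inj.
  have := psi_lin (-1) 0 0; rewrite !scaleN1r addNr => ->.
  by rewrite addNr.
- by move=> x; apply: dhomog_is_dhomog.
by move=> p hp; exists (psi (DHomog hp)); rewrite psiK.
Qed.

Lemma graded_frame_exists k (D : 'I_k -> nat) :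
  exists phi : 'rV[K]_(\sum_i hilb (D i)) -> 'I_k -> S, graded_frame D phi.
Proof.
have [phi phiP] : exists phi : forall k, 'rV[K]_(hilb k) -> S, forall k,
    [/\ forall c x y, phi k (c *: x + y) = c *: phi k x + phi k y,
        forall x, phi k x = 0 -> x = 0,
        forall x, phi k x \is k.-homog &
        forall p, p \is k.-homog -> exists x, phi k x = p].
  pose sel l := constructive_indefinite_description _ (homog_coordinates l).
  by exists (fun l => proj1_sig (sel l)) => l; apply: (proj2_sig (sel l)).
exists (fun x i => phi (D i) (submxrow x i)); split.
- move=> c x y i; have [lin _ _ _] := phiP (D i).
  rewrite -lin; congr phi; apply/rowP => j; rewrite !mxE //.
- move=> x x0; apply/mxrowP => i; have [_ inj _ _] := phiP (D i).
  by rewrite submxrow0; apply: inj.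
- by move=> x i; have [_ _ hom _] := phiP (D i).
move=> v hv; have ex i : exists x, phi (D i) x = v i.
  by have [_ _ _ surj] := phiP (D i); apply: surj.
pose sel i := constructive_indefinite_description _ (ex i).
exists (\mxrow_i proj1_sig (sel i)) => i; rewrite mxrowK.
exact: (proj2_sig (sel i)).
Qed.

Lemma linear_fun_sum (U V : lmodType K) (phi : U -> V) (I : finType) (c : I -> K) (y : I -> U) :
    (forall c y z, phi (c *: y + z) = c *: phi y + phi z) ->
  phi (\sum_i c i *: y i) = \sum_i c i *: phi (y i).
Proof.
move=> lin; have phi0 : phi 0 = 0.
  by have := lin (-1) 0 0; rewrite !scaleN1r !addNr.
apply: (big_rec2 (fun u v => phi u = v)) => [//|i u v _ <-].
by rewrite lin.
Qed.

Lemma row_delta_sum n (x : 'rV[K]_n) : x = \sum_i x ord0 i *: delta_mx ord0 i.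
Proof.
apply/rowP => j; rewrite summxE (bigD1 j) //= big1 ?addr0 => [|i ij].
  by rewrite !mxE !eqxx mulr1.
by rewrite !mxE [j == i]eq_sym (negPf ij) andbF mulr0.
Qed.

Lemma graded_matrix (I J : finType) (D : I -> nat) (D' : J -> nat) n n'
    (phi : 'rV[K]_n -> I -> S) (phi' : 'rV[K]_n' -> J -> S) (A : I -> J -> S) :
    graded_frame D phi -> graded_frame D' phi' ->
    (forall v, (forall i, v i \is (D i).-homog) ->
       forall j, \sum_i v i * A i j \is (D' j).-homog) ->
  exists M : 'M[K]_(n, n'), forall x j, \sum_i phi x i * A i j = phi' (x *m M) j.
Proof.
move=> [lin _ hom _] [lin' _ _ surj'] homA.
have ex k : exists y, forall j, phi' y j = \sum_i phi (delta_mx ord0 k) i * A i j.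
  by apply: surj'; apply: homA; apply: hom.
pose sel k := constructive_indefinite_description _ (ex k).
exists (\matrix_k proj1_sig (sel k)) => x j; rewrite mulmx_sum_row.
rewrite (linear_fun_sum (phi := fun y => phi' y j)) //.
under [RHS]eq_bigr do rewrite rowK (proj2_sig (sel _)) scaler_sumr.
rewrite exchange_big /=; apply: eq_bigr => i _.
rewrite {1}(row_delta_sum x) (linear_fun_sum (phi := fun y => phi y i)) //.
by rewrite mulr_suml; apply: eq_bigr => k _; rewrite scalerAl.
Qed.

Lemma rank_exact n0 n1 n2 (M0 : 'M[K]_(n0, n1)) (M1 : 'M[K]_(n1, n2)) :
    (forall x : 'rV_n1, x *m M1 = 0 <-> exists y : 'rV_n0, x = y *m M0) ->
  (\rank M1 = n1 - \rank M0)%N.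
Proof.
move=> ex; have kerE : (kermx M1 :=: M0)%MS.
  apply/eqmxP/andP; split; apply/row_subP => i.
    have [|y ->] := (ex (row i (kermx M1))).1; last exact: submxMl.
    by rewrite -row_mul mulmx_ker row0.
  by apply/sub_kermxP; apply/ex; exists (delta_mx ord0 i); rewrite rowE.
by rewrite -kerE mxrank_ker subKn // rank_leq_row.
Qed.

(** Along the exact complex the ranks are successively [n0], [n1 - n0] and [n2 - (n1 - n0)]; the
    number of basis elements is the corank of the last map. *)
Lemma graded_cokernel (I0 I1 I2 : finType) (D0 : I0 -> nat) (D1 : I1 -> nat) (D2 : I2 -> nat)
    (k n0 n1 n2 n3 : nat) (phi0 : 'rV[K]_n0 -> I0 -> S) (phi1 : 'rV[K]_n1 -> I1 -> S)
    (phi2 : 'rV[K]_n2 -> I2 -> S) (phi3 : 'rV[K]_n3 -> 'I_1 -> S)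
    (A0 : I0 -> I1 -> S) (A1 : I1 -> I2 -> S) (A2 : I2 -> S)
    (e0 : I0 -> I1 -> nat) (e1 : I1 -> I2 -> nat) (e2 : I2 -> nat) :
    graded_frame D0 phi0 -> graded_frame D1 phi1 -> graded_frame D2 phi2 ->
    graded_frame (fun=> k) phi3 ->
    (forall i j, A0 i j \is (e0 i j).-homog) -> (forall i j, D0 i + e0 i j = D1 j)%N ->
    (forall i j, A1 i j \is (e1 i j).-homog) -> (forall i j, D1 i + e1 i j = D2 j)%N ->
    (forall i, A2 i \is (e2 i).-homog) -> (forall i, D2 i + e2 i = k)%N ->
    (forall v, (forall j, \sum_i v i * A0 i j = 0) -> forall i, v i = 0) ->
    (forall v, (forall j, \sum_i v i * A1 i j = 0) <->
               exists w, forall i, v i = \sum_l w l * A0 l i) ->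
    (forall v, \sum_i v i * A2 i = 0 <-> exists w, forall i, v i = \sum_l w l * A1 l i) ->
  exists b : 'I_(n3 - (n2 - (n1 - n0))) -> S, [/\ forall i, b i \is k.-homog,
    forall c : 'I_(n3 - (n2 - (n1 - n0))) -> K,
      (exists a, \sum_i c i *: b i = \sum_i a i * A2 i) -> forall i, c i = 0 &
    forall p, p \is k.-homog -> exists c a, p - \sum_i c i *: b i = \sum_i a i * A2 i].
Proof.
move=> F0 F1 F2 F3 h0 eD0 h1 eD1 h2 eD2 inj0 ex1 ex2.
have homA (I J : finType) (D : I -> nat) (D' : J -> nat) (A : I -> J -> S) (e : I -> J -> nat) :
    (forall i j, A i j \is (e i j).-homog) -> (forall i j, D i + e i j = D' j)%N ->
    forall v, (forall i, v i \is (D i).-homog) ->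
       forall j, \sum_i v i * A i j \is (D' j).-homog.
  by move=> hA eD v hv j; apply: rpred_sum => i _; rewrite -(eD i j); apply: dhomogM.
have [M0 M0E] := graded_matrix F0 F1 (homA _ _ _ _ _ _ h0 eD0).
have [M1 M1E] := graded_matrix F1 F2 (homA _ _ _ _ _ _ h1 eD1).
have [M2 M2E] := graded_matrix F2 F3
  (homA _ _ _ (fun _ : 'I_1 => k) (fun i _ => A2 i) (fun i _ => e2 i)
     (fun i _ => h2 i) (fun i _ => eD2 i)).
have [lin0 pinj0 hom0 surj0] := F0; have [lin1 pinj1 hom1 surj1] := F1.
have [lin2 pinj2 hom2 surj2] := F2; have [lin3 pinj3 hom3 surj3] := F3.
have zero (I : finType) n (D : I -> nat) (phi : 'rV[K]_n -> I -> S) i :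
    graded_frame D phi -> phi 0 i = 0.
  by case=> lin _ _ _; have := lin (-1) 0 0 i; rewrite !scaleN1r !addNr.
have inj_eq (I : finType) n (D : I -> nat) (phi : 'rV[K]_n -> I -> S) x y :
    graded_frame D phi -> (forall i, phi x i = phi y i) -> x = y.
  case=> lin inj _ _ xy; apply/eqP; rewrite -subr_eq0; apply/eqP/inj => i.
  by rewrite -scaleN1r addrC lin xy scaleN1r addNr.
have r0 : \rank M0 = n0.
  have ker0 : kermx M0 = 0.
    apply/row_matrixP => i; rewrite row0; set x := row i _.
    have xM : x *m M0 = 0 by rewrite -row_mul mulmx_ker row0.
    by apply: pinj0; apply: inj0 => j; rewrite M0E xM (zero _ _ _ _ _ F1).
  have := mxrank_ker M0; rewrite ker0 mxrank0 => /esym/eqP; rewrite subn_eq0 => n0_le.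
  by apply/eqP; rewrite eqn_leq rank_leq_row.
have r1 : \rank M1 = (n1 - n0)%N.
  rewrite -[in RHS]r0; apply: rank_exact => x; split=> [xM|[y ->]].
    have [|w wE] := (ex1 (phi1 x)).1; first by move=> j; rewrite M1E xM (zero _ _ _ _ _ F2).
    have := homog_lift h0 eD0 (hom1 x) wE.
    have [y yE] := surj0 _ (fun i => pihomogP mdeg (D0 i) (w i)).
    move=> xE; exists y; apply: (inj_eq _ _ _ _ _ _ F1) => i.
    by rewrite -M0E xE; apply: eq_bigr => l _; rewrite yE.
  apply: pinj2 => j; rewrite -M1E; move: j; apply/ex1.
  by exists (phi0 y) => i; rewrite M0E.
have r2 : \rank M2 = (n2 - (n1 - n0))%N.
  rewrite -[in RHS]r1; apply: rank_exact => x; split=> [xM|[y ->]].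
    have [|w wE] := (ex2 (phi2 x)).1.
      by have := M2E x ord0; rewrite xM (zero _ _ _ _ _ F3).
    have := homog_lift h1 eD1 (hom2 x) wE.
    have [y yE] := surj1 _ (fun i => pihomogP mdeg (D1 i) (w i)).
    move=> xE; exists y; apply: (inj_eq _ _ _ _ _ _ F2) => i.
    by rewrite -M1E xE; apply: eq_bigr => l _; rewrite yE.
  apply: pinj3 => j; rewrite -M2E; apply/ex2.
  by exists (phi1 y) => i; rewrite M1E.
rewrite -r2 -mxrank_compl.
(* A basis of a complement of the image represents a basis of the cokernel. *)
set N := (M2^C)%MS; pose B := row_base N.
exists (fun i => phi3 (row i B) ord0); split=> [i|c [a aE]|p hp].
- exact: hom3.
- pose x : 'rV_(\rank N) := \row_i c i.
  have xE : phi3 (x *m B) ord0 = \sum_i a i * A2 i.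
    rewrite -aE mulmx_sum_row (linear_fun_sum (phi := fun y => phi3 y ord0)) //.
    by apply: eq_bigr => i _; rewrite mxE.
  have := @homog_lift I2 'I_1 (fun i _ => A2 i) (fun i _ => e2 i) D2 (fun=> k)
     (phi3 (x *m B)) a (fun i _ => h2 i) (fun i _ => eD2 i) (hom3 _).
  move=> lift; have {lift} xE' : phi3 (x *m B) ord0 = \sum_i pihomog mdeg (D2 i) (a i) * A2 i.
    by apply: lift => j; rewrite (ord1 j).
  have [y yE] := surj2 _ (fun i => pihomogP mdeg (D2 i) (a i)).
  have xy : x *m B = y *m M2.
    apply: (inj_eq _ _ _ _ _ _ F3) => i; rewrite (ord1 i) xE' -M2E.
    by apply: eq_bigr => l _; rewrite yE.
  have : (x *m B <= M2 :&: N)%MS.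
    by rewrite sub_capmx {1}xy submxMl -(eq_row_base N) submxMl.
  rewrite capmx_compl submx0 => /eqP xB0 i.
  have x0 : x = 0 by apply: (row_free_inj (row_base_free N)); rewrite mul0mx.
  by have := congr1 (fun z : 'rV_(\rank N) => z ord0 i) x0; rewrite !mxE.
have [y yE] := surj3 (fun=> p) (fun=> hp).
have : (y <= M2 + N)%MS by rewrite submx_full // addsmx_compl_full.
case/sub_addsmxP => -[u w] /= ywE.
have [z zE] : exists z, w *m N = z *m B.
  by apply/submxP; rewrite (eq_row_base N) submxMl.
exists (fun i => z ord0 i), (phi2 u).
rewrite -(yE ord0) ywE zE (M2E u ord0) -(linear_fun_sum (phi := fun y => phi3 y ord0)) //.
by rewrite -mulmx_sum_row -[u *m M2]scale1r lin3 !scale1r addrK.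
Qed.

Lemma hilb2 k : (2 * hilb k = (k + 2) * (k + 1))%N.
Proof.
have -> : 'C(k + 2, k) = 'C(k.+2, 2) by rewrite -(@bin_sub _ k) ?leq_addr // addKn addn2.
by rewrite bin2 mul2n halfK oddM /= negbK andbN subn0 addn2 addn1.
Qed.

(** Raising the degree from [E] by 1 adds [E + 2] monomials and by 2 adds [2 * (E + 2) + 1]. The sum
    over [q] thus depends only on its size, its total [n] and the number [s] of entries equal to
    2. *)
Lemma hilbert_count (n s E : nat) (q : seq nat) :
    {in q, forall x, x <= 2}%N -> (\sum_(x <- q) x = n)%N -> count (pred1 2%N) q = s ->
    (2 <= size q)%N ->
  (hilb (E + 2 * n) - (3 * hilb (E + n) -
     (\sum_(x <- q) hilb (E + x) - (size q - 2) * hilb E)) = 'C(n.+1, 2) + s)%N.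
Proof.
move=> q2 sum_q cnt_q size_q.
have sumE : (\sum_(x <- q) hilb (E + x) = size q * hilb E + n * (E + 2) + s)%N.
  rewrite -sum_q -cnt_q; elim: q q2 {sum_q cnt_q size_q} => [|x q IHq] q2.
    by rewrite !big_nil mul0n.
  rewrite !big_cons IHq /= => [|y yq]; last by apply: q2; rewrite inE yq orbT.
  have : (x <= 2)%N by apply: q2; rewrite mem_head.
  clear q2 IHq.
  have := hilb2 E; have := hilb2 (E + 1); have := hilb2 (E + 2).
  case: x => [|[|[|]]] //=; rewrite ?addn0; nia.
have s_le : (s <= n)%N.
  rewrite -sum_q -cnt_q; elim: q {q2 sum_q cnt_q size_q sumE} => [//|x q IHq].
  by rewrite big_cons /=; apply: leq_add => //; case: eqP => [->|].
have hb : (2 * 'C(n.+1, 2) = n.+1 * n)%N.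
  by rewrite bin2 /= mul2n halfK oddM /= andNb subn0.
have := hilb2 E; have := hilb2 (E + n); have := hilb2 (E + 2 * n); rewrite sumE.
move: hb; move: 'C(n.+1, 2) (hilb E) (hilb (E + n)) (hilb (E + 2 * n)) => c h0 h1 h2.
move=> hb e2 e1 e0.
have -> : (size q * h0 + n * (E + 2) + s - (size q - 2) * h0 = 2 * h0 + n * (E + 2) + s)%N.
  by have := leq_mul size_q (leqnn h0); rewrite mulnBl; lia.
have : (2 * h2 + 2 * (2 * h0 + n * (E + 2) + s) = 2 * (3 * h1) + 2 * (c + s))%N.
  by nia.
(* Ensures that the truncated subtraction from [3 * h1] is a true one. *)
have : (2 * h0 + n * (E + 2) + s <= 3 * h1)%N.
  have : (2 * (2 * h0 + n * (E + 2) + s) <= 2 * (3 * h1))%N by lia.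
  by lia.
by lia.
Qed.

Lemma pihomog_lt (p q : S) b k : q \is b.-homog -> (k < b)%N -> pihomog mdeg k (p * q) = 0.
Proof.
move=> hq kb; have hpi i : pihomog mdeg i p * q \is (i + b).-homog.
  by apply: dhomogM => //; apply: pihomogP.
rewrite (pihomog_partitionE (leqnn (msize p))) mulr_suml raddf_sum big1 // => i _.
by apply: pihomog_ne0 (hpi i); rewrite neq_ltn ltn_addl ?orbT.
Qed.

(** * Invariants of the arrangement read off the resolution *)

Section CoveredArrangement.

Variables (ls : seq vec3) (L : vec3) (r : seq vec3).
Hypothesis lines : distinct_lines (rcons ls L).
Hypothesis nodal_ls : nodal ls.
Hypothesis cover : pencil_cover ls L r.

Local Notation m := (size r).
Local Notation f := (arr_poly (rcons ls L)).
Local Notation q j := (pt_mult ls (axis_pt (r := r) j)).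

Lemma cover_frame : exists fa fb fw : vec3, forall i j, (i == j)%:R =
  axis_pt (Ordinal (cover_gt0 cover)) ord0 i * fa ord0 j +
  axis_pt (Ordinal (cover_gt1 cover)) ord0 i * fb ord0 j + fw ord0 i * L ord0 j.
Proof.
apply: plane_frame; [exact: axis_neq0 lines | exact: axis_pt_dot cover _ |
  exact: axis_pt_dot cover _ |].
apply: normalized_indep; try exact: (axis_pt_normalized cover).
by rewrite (inj_eq (axis_pt_inj cover)).
Qed.

(** Packages the complex without the choice of frame. Divisibility of relation coefficients by the
    pencils is kept because irredundancy rests on it. *)
Lemma pencil_resolution : generates f (gen ls (r := r)) /\
  exists R : 'I_(m - 2) -> 'I_m -> S,
  [/\ forall i j, R i j \is (q j).-homog,
      forall i l, \sum_j R i j * gen ls j l = 0,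
      forall h : 'I_m -> S, (forall l, \sum_j h j * gen ls j l = 0) ->
        (exists c : 'I_(m - 2) -> S, forall j, h j = \sum_i c i * R i j) /\
        (forall j, exists u, h j = pencil ls j * u) &
      forall c : 'I_(m - 2) -> S, (forall j, \sum_i c i * R i j = 0) -> forall i, c i = 0].
Proof.
have [fa [fb [fw frame]]] := cover_frame.
split; first exact: (gen_generates lines nodal_ls frame).
exists (pencil_rel cover fa fb); split=> [i j|i l|h h0|c c0].
- by rewrite /pencil_rel mul_mpolyC; apply/rpredZ/pencil_homog.
- exact: (rel_gen lines frame).
- by split; [exact: (rel_generates lines frame) | exact: (pencil_dvd_relation lines frame)].
exact: (rel_inj lines c0).
Qed.

Lemma jac_homog i : jac f i \is (size ls).-homog.
Proof. by have [] := mderiv_homog i (arr_poly_homog (rcons ls L)); rewrite size_rcons. Qed.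

Lemma mult_axis_le2 j : (q j <= 2)%N.
Proof. by apply/nodal_ls/normalized_neq0/(axis_pt_normalized cover). Qed.

Lemma mult_axis_le j : (q j <= size ls)%N.
Proof. exact: count_size. Qed.

(** With [n = size ls], the complex in degree [E + 2 * n] involves forms of degrees [E], [E + q j],
    [E + n] and [E + 2 * n]. From degree [2 * n] on, all these are nonnegative and the count no
    longer depends on [E]. *)
Lemma covered_tjurina s : count (fun p => pt_mult ls p == 2%N) r = s ->
  tjurina f ('C((size ls).+1, 2) + s)%N.
Proof.
move=> num_s; exists (2 * size ls)%N => k /subnK; rewrite addnC.
move: (k - _)%N => E <-; rewrite addnC; set n := size ls.
have [gen_f [R [hR relR exR injR]]] := pencil_resolution.
have [phi0 F0] := graded_frame_exists (fun _ : 'I_(m - 2) => E).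
have [phi1 F1] := graded_frame_exists (fun j : 'I_m => E + q j)%N.
have [phi2 F2] := graded_frame_exists (fun _ : 'I_3 => E + n)%N.
have [phi3 F3] := graded_frame_exists (fun _ : 'I_1 => E + 2 * n)%N.
have hc : (hilb (E + 2 * n) - (3 * hilb (E + n) -
    (\sum_(j < m) hilb (E + q j) - (m - 2) * hilb E)) = 'C(n.+1, 2) + s)%N.
  have -> : (\sum_(j < m) hilb (E + q j) = \sum_(x <- map (pt_mult ls) r) hilb (E + x))%N.
    by rewrite big_map (big_nth 0) big_mkord.
  rewrite -(size_map (pt_mult ls) r); apply: hilbert_count; rewrite ?size_map.
  - move=> x /mapP[p pr ->]; apply/nodal_ls/normalized_neq0.
    by have [_ _ rP _] := cover; have [] := rP p pr.
  - by rewrite big_map; exact: (sum_mult_cover lines cover).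
  - by rewrite -num_s count_map.
  by have [] := cover.
have := @graded_cokernel _ _ _ _ _ _ _ _ _ _ _ _ _ _ _ R (gen ls (r := r)) (jac f)
  (fun _ j => q j) (fun j _ => n - q j)%N (fun=> n) F0 F1 F2 F3.
rewrite !sum_nat_const !card_ord mul1n hc.
case=> //.
- by move=> j i; have := gen_homog lines cover j i.
- by move=> j _; have := mult_axis_le j; rewrite -/n; lia.
- exact: jac_homog.
- by move=> _; lia.
- move=> v; split=> [/exR [] //|[w vE] l].
  under eq_bigr do rewrite vE mulr_suml.
  rewrite exchange_big big1 //= => i _; under eq_bigr do rewrite -mulrA.
  by rewrite -mulr_sumr relR mulr0.
- move=> v; split=> [/gen_f //|[w vE]].
  transitivity (vderiv (fun i => \sum_l w l * gen ls l i) f).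
    by apply: eq_bigr => i _; rewrite vE.
  rewrite vderiv_suml big1 // => l _.
  by have := gen_syz lines cover l; rewrite syzE => ->; rewrite mulr0.
by move=> b [hb ib sb]; exists b.
Qed.

Lemma pencil_meval j u : (0 < q j)%N -> (pencil ls j * u).@[fun i => axis_pt j ord0 i] = 0.
Proof.
rewrite /pt_mult -has_count => /hasP[l lls lj].
rewrite mevalM /pencil rmorph_prod /=; apply/eqP; rewrite mulf_eq0; apply/orP; left.
rewrite prodf_seq_eq0; apply/hasP; exists l => //.
by rewrite lj linform_meval -on_lineE lj.
Qed.

(** A redundancy is a relation with coefficient -1 at [j]; but that coefficient is a multiple of
    [pencil j], which vanishes at the centre once a line passes through it. *)
Lemma gen_nonredundant j (h : 'I_m -> S) : (0 < q j)%N ->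
  ~ forall i, gen ls j i = \sum_(l < m | l != j) h l * gen ls l i.
Proof.
move=> qj genE; have [_ [R [_ _ exR _]]] := pencil_resolution.
have [|_ /(_ j) [u]] := exR (fun l => if l == j then -1 else h l).
  move=> i; rewrite (bigD1 j) //= eqxx mulN1r genE.
  apply/eqP; rewrite addrC subr_eq0; apply/eqP/eq_bigr => l /negPf -> //.
rewrite eqxx => e; have := pencil_meval u qj; rewrite -e mevalN meval1.
by move/eqP; rewrite oppr_eq0 oner_eq0.
Qed.

(** The generator at a double point attains the degree, and is nonzero because it is not redundant.
    As [q j <= 2], no generator has smaller degree. *)
Lemma covered_mdr : has (fun p => pt_mult ls p == 2%N) r -> mdr f (size ls - 2).
Proof.
case/hasP=> p pr /eqP p2; have [gen_f _] := pencil_resolution.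
have ip : (index p r < m)%N by rewrite index_mem.
pose j : 'I_m := Ordinal ip.
have qj : q j = 2%N by rewrite /axis_pt nth_index.
split.
  exists (gen ls j); split; first exact: gen_syz lines cover j.
  split; first by have := gen_homog lines cover j; rewrite qj.
  apply: NNPP => no; apply: (@gen_nonredundant j (fun=> 0)); first by rewrite qj.
  move=> i; rewrite big1 => [|l _]; last by rewrite mul0r.
  by apply/eqP/negPn/negP => gen0; apply: no; exists i.
move=> r' v lt_r' /gen_f [h vE] hv i.
rewrite -(pihomog_dE (hv i)) vE raddf_sum big1 //= => l _.
apply: (pihomog_lt _ (gen_homog lines cover l i)).
by have := mult_axis_le2 l; lia.
Qed.

Section AllDouble.

Hypothesis all2 : {in r, forall p, pt_mult ls p = 2%N}.

Let q2 j : q j = 2%N. Proof. exact/all2/axis_pt_mem. Qed.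

Lemma covered_arr_type : arr_type f (size ls - 2) m.
Proof.
have [gen_f _] := pencil_resolution.
exists (gen ls (r := r)); split; first exact: gen_syz lines cover.
split; first by move=> j; have := gen_homog lines cover j; rewrite q2.
split=> // j [h]; apply: gen_nonredundant; by rewrite q2.
Qed.

(** The final [+ 2] is the degree of the pencils that appear as relation entries, that is
    [epsilon_j]. *)
Lemma covered_min_free_res : (2 < size ls)%N ->
  min_free_res f (size ls).+1 (fun _ : 'I_m => size ls - 2)%N
    (fun _ : 'I_(m - 2) => (size ls).+1 + (size ls - 2) - 1 + 2)%N.
Proof.
move=> ls3; have [gen_f [R [hR relR exR injR]]] := pencil_resolution.
exists (gen ls (r := r)), R; split; first exact: gen_syz lines cover.
split; first by move=> j; have := gen_homog lines cover j; rewrite q2.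
(* More than two lines in [ls] make the common generator degree positive, so the clause on degree 0
   is vacuous. *)
split; first by move=> j i e; exfalso; lia.
split=> //; split=> //; split.
  by move=> i j; rewrite (_ : (_ - _)%N = q j); [exact: hR | rewrite q2; lia].
split; first by move=> j i e; exfalso; lia.
by split=> // h /exR [].
Qed.

End AllDouble.

End CoveredArrangement.

Theorem theorem6p2 (ls : seq vec3) (L : vec3) (s : nat) :
  (2 <= size ls)%N ->
  line_arrangement ls ->
  nodal ls ->
  L != 0 ->
  (forall l, l \in ls -> ~ proportional L l) ->
  num_points (fun p => pt_mult ls p = 2%N /\ on_line L p) s ->
  (1 <= s)%N ->
  let A := rcons ls L in
  let f := arr_poly A in
  let d := (size ls).+1 in
  ((exists n2 : nat, num_points (fun p => pt_mult A p = 2%N) n2 /\ (n2 + 3 * s)%N = 'C(d, 2)) /\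
   num_points (fun p => pt_mult A p = 3%N) s /\
   (forall p : vec3, p != 0 -> (pt_mult A p <= 3)%N) /\
   (2 * s <= size ls)%N /\
   tjurina f ('C(d, 2) + s)%N /\
   mdr f (d - 3)%N) /\
  (forall k : nat, size ls = (2 * k)%N -> (4 <= size ls)%N -> s = k ->
     let r := (2 * k - 2)%N in
     arr_type f r k /\
     ((2 * r)%:Z - d%:Z + 3 - k%:Z = k%:Z - 2 :> int) /\
     exists (dd : 'I_k -> nat) (ee : 'I_(k - 2) -> nat),
       min_free_res f d dd ee /\
       (forall j, dd j = r) /\
       (forall i, ee i = (d + r - 1 + 2)%N)).
Proof.
move=> ls2 /distinct_linesP arr nodal_ls L0 npL num_s s1 A f d.
have lines := distinct_lines_rcons arr L0 npL.
split.
  split; first exact: double_points.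
  split; first exact: triple_points.
  split; first exact: added_mult_le3.
  split; first exact: (axis_double_le lines num_s).
  have [r [cover count_s]] := pencil_cover_exists lines num_s.
  split; first exact: (covered_tjurina lines nodal_ls cover count_s).
  by apply: (covered_mdr lines nodal_ls cover); rewrite has_count count_s.
move=> k size_ls ls4 sk r; subst k.
(* The cover used for the first part may contain points on no line, whose generators are redundant.
   This one consists of the double points only, so its size is the number of minimal generators. *)
have [||t [cover size_t all2]] := pencil_cover_doubles lines num_s; first by lia.
  by [].
have type := covered_arr_type lines nodal_ls cover all2.
have res := covered_min_free_res lines nodal_ls cover all2 (ltnW ls4).
have er : (size ls - 2 = r)%N by rewrite size_ls.
move: type res; rewrite er size_t => type res.
split=> //; split; first by rewrite /d size_ls /r; lia.
by exists (fun=> r), (fun=> (d + r - 1 + 2)%N).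
Qed.
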